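(* Let $A=(a_1,\ldots,a_n)\in\mathbb N^n$ (positive integers) have pairwise distinct entries, written in increasing order $a_1<\cdots<a_n$, and let $\imath_A:\mathrm{sh}^{(n)}\hookrightarrow\mathbb P(M^A)$ be the embedding realizing $\mathrm{sh}^{(n)}$ as $\mathrm{sh}_A$. Then $\imath_A^*\mathcal O(1)\simeq\mathcal O(a_1-1,a_2-1,\ldots,a_n-1)$.
   Context: Fusion products. Let $e,h,f$ be the standard basis of $\mathfrak{sl}_2(\mathbb C)$ and write $x_j=x\otimes t^j$. For positive integers $A=(a_1,\ldots,a_n)$ choose pairwise distinct $z_1,\ldots,z_n\in\mathbb C$, let $\mathbb C^{a}$ be the $a$-dimensional irreducible $\mathfrak{sl}_2$-module, and $\mathbb C^{a_i}(z_i)$ the $\mathfrak{sl}_2\otimes\mathbb C[t]$-module on which $x_j$ acts as $z_i^jx$. Let $\overline{v_A}\in\bigotimes_i\mathbb C^{a_i}(z_i)$ be the tensor product of lowest weight vectors and $F_s$ the span of all $x^{(1)}_{i_1}\cdots x^{(k)}_{i_k}\overline{v_A}$ with $x^{(j)}\in\mathfrak{sl}_2$, $i_1+\cdots+i_k\le s$. The fusion product is the associated graded $\mathfrak{sl}_2\otimes\mathbb C[t]$-module $M^A=\bigoplus_sF_s/F_{s-1}$, with $v_A$ the image of $\overline{v_A}$. Known facts: $\mathfrak{sl}_2\otimes t^j$ acts by $0$ for $j\ge n$; $M^A=\mathbb C[e_0,\ldots,e_{n-1}]v_A\simeq\mathbb C[e_0,\ldots,e_{n-1}]/I_A$ with $I_A$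 generated by $\sum_{i_1+\cdots+i_k=s}e_{n-1-i_1}\cdots e_{n-1-i_k}$ for $k\ge1$, $s<\sum_{j=1}^n\max(k+1-a_j,0)$ (so $M^A$ does not depend on the $z_i$); $\dim M^A=\prod a_i$. Schubert variety. $\mathrm G=SL_2(\mathbb C[t]/t^n)$ acts on $M^A$ and on $\mathbb P(M^A)$; $[v]$ denotes the line $\mathbb Cv$ ($\mathbb P$ is the space of lines, so $H^0(\mathbb P(M^A),\mathcal O(1))=(M^A)^*$); $\mathrm{sh}_A=\overline{\mathrm G\cdot[v_A]}\subset\mathbb P(M^A)$. For $a_1<\cdots<a_n$ the variety $\mathrm{sh}_A$, regarded up to isomorphism as depending only on $n$, is denoted $\mathrm{sh}^{(n)}$. Line bundles. For $0\le i\le n-1$ let $C_i=\overline{\{\exp(\tau e_i)\cdot[v_A]:\tau\in\mathbb C\}}\subset\mathrm{sh}^{(n)}$, where $\mathrm{sh}^{(n)}$ is identified with $\mathrm{sh}_A$ for some $A$ with no coinciding entries; these are projective lines, regarded as independent of the choice of $A$. A line bundle on $\mathrm{sh}^{(n)}$ is determined by its restrictions to $C_0,\ldots,C_{n-1}$, and $\mathrm{Pic}(\mathrm{sh}^{(n)})=\mathbb Z^n$. If $\mathcal E$ is a line bundle with $\mathcal E|_{C_i}\simeq\mathcal O(b_i)$, it is denoted $\mathcal O(b_{n-1},b_{n-2}-b_{n-1},b_{n-3}-b_{n-2},\ldots,b_0-b_1)$; equivalently, $\mathcal O(c_1,\ldots,c_n)$ restricts to $C_i$ as $\mathcal O_{\mathbb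 P^1}(c_1+\cdots+c_{n-i})$ for $i=0,\ldots,n-1$. *)

(* Defs.v *)
From HB Require Import structures.
From mathcomp Require Import all_boot all_order all_algebra.
From mathcomp Require Import mpoly complex reals boolp.

Set Implicit Arguments.
Unset Strict Implicit.
Unset Printing Implicit Defensive.

Import GRing.Theory.
Local Open Scope ring_scope.

(* Projective varieties in the classical sense.  A point of P(V), i.e. a line *)
(* of V, is a 1-dimensional L : {vspace V}; subsets of P(V) are predicates on *)
(* {vspace V}, and functions and maps on a subset X of P(V) are total on      *)
(* {vspace V}, their values outside X being irrelevant.                       *)

Section Zariski.
Variables (F : fieldType) (V : vectType F).
Implicit Types (X U W Z : {vspace V} -> Prop) (L : {vspace V}).

Definition PP L : Prop := \dim L = 1%N.

Definition hev (p : {mpoly F[\dim {:V}]}) (v : V) : F :=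
  p.@[fun i => coord (vbasis {:V}) i v].

Definition vanishes_on (p : {mpoly F[\dim {:V}]}) L : Prop :=
  forall v, v \in L -> hev p v = 0.

Definition zclosure X L : Prop :=
  PP L /\ forall d p, p \is d.-homog ->
    (forall L', X L' -> vanishes_on p L') -> vanishes_on p L.

Definition zclosed Z : Prop := forall L, zclosure Z L -> Z L.

(* open in X for the topology induced by P(V) *)
Definition zopen X U : Prop :=
  exists Z, zclosed Z /\ forall L, U L <-> X L /\ ~ Z L.

Definition regular U (f : {vspace V} -> F) : Prop :=
  forall L, U L -> exists W d p q,
    [/\ zopen U W, W L, p \is d.-homog, q \is d.-homog &
        forall L' v, W L' -> v \in L' -> v != 0 ->
          hev q v != 0 /\ f L' = hev p v / hev q v].

Lemma zclosure_mono X Y :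
  (forall L, X L -> Y L) -> forall L, zclosure X L -> zclosure Y L.
Proof.
move=> sXY L [PL HL]; split=> // d p hp Hp.
by apply: (HL d) => // L' /sXY; exact: Hp.
Qed.

Lemma PP_vpick L : PP L -> vpick L != 0.
Proof. by move=> PL; rewrite vpick0 -dimv_eq0 PL. Qed.

Lemma PP_scale L v w : PP L -> v \in L -> v != 0 -> w \in L -> exists c, w = c *: v.
Proof.
move=> PL vL v0 wL; apply/vlineP.
suff -> : <[v]>%VS = L by [].
by apply/eqP; rewrite eqEdim -memvE vL PL dim_vline v0.
Qed.

Lemma PP_vline v : v != 0 -> PP <[v]>.
Proof. by move=> v0; rewrite /PP dim_vline v0. Qed.

Lemma hevZ d p c v : p \is d.-homog -> hev p (c *: v) = c ^+ d * hev p v.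
Proof.
move=> /dhomogP hp; rewrite /hev !mevalE mulr_sumr.
rewrite big_seq [RHS]big_seq; apply: eq_bigr => m /hp /= <-.
rewrite mulrCA; congr (_ * _).
rewrite mdegE -prodrXr -big_split /=; apply: eq_bigr => i _.
by rewrite linearZ /= exprMn.
Qed.

Lemma hevM p q v : hev (p * q) v = hev p v * hev q v.
Proof. exact: mevalM. Qed.

Lemma zclosed_empty : zclosed (fun=> False).
Proof.
move=> L [PL HL].
have /(_ _ (memv_pick L))/eqP : vanishes_on 1 L.
  by apply: (HL 0%N) => //; exact: dhomog1.
by rewrite /hev meval1 oner_eq0.
Qed.

Lemma zclosed_vanish d p : p \is d.-homog -> zclosed (fun L => PP L /\ vanishes_on p L).
Proof. by move=> hp L [PL HL]; split=> //; apply: (HL d) => // L' []. Qed.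

Lemma zclosedU Z1 Z2 : zclosed Z1 -> zclosed Z2 -> zclosed (fun L => Z1 L \/ Z2 L).
Proof.
move=> cZ1 cZ2 L [PL HL]; have v0 := PP_vpick PL.
have [ZL|nZ1] := pselect (Z1 L); first by left.
right; apply: cZ2; split=> // e q hq Hq w wL.
apply: contrapT => qw; apply: nZ1; apply: cZ1; split=> // d p hp Hp u uL.
have [c wE] := PP_scale PL (memv_pick L) v0 wL.
have [c' ->] := PP_scale PL (memv_pick L) v0 uL.
have qv : hev q (vpick L) != 0.
  by apply/eqP => q0; case: qw; rewrite wE (hevZ _ _ hq) q0 mulr0.
have : vanishes_on (p * q) L.
  apply: (HL _ _ (dhomogM hp hq)) => L' [/Hp|/Hq] h x xL'.
    by rewrite hevM h ?mul0r.
  by rewrite hevM h ?mulr0.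
move=> /(_ _ (memv_pick L))/eqP.
rewrite hevM mulf_eq0 (negbTE qv) orbF (hevZ _ _ hp) => /eqP ->.
by rewrite mulr0.
Qed.

Lemma zopenxx X : zopen X X.
Proof.
exists (fun=> False); split; first exact: zclosed_empty.
by move=> L; split=> [XL|[XL _]] //; split=> // -[].
Qed.

Lemma zopenI X U1 U2 : zopen X U1 -> zopen X U2 -> zopen X (fun L => U1 L /\ U2 L).
Proof.
move=> [Z1 [c1 E1]] [Z2 [c2 E2]]; exists (fun L => Z1 L \/ Z2 L).
split=> [|L]; first exact: zclosedU.
by rewrite E1 E2; split=> [[[XL n1] [_ n2]]|[XL n]]; intuition.
Qed.

End Zariski.

Record morphism (F : fieldType) (V W : vectType F)
    (X : {vspace V} -> Prop) (Y : {vspace W} -> Prop) := Morphism {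
  mor_fun :> {vspace V} -> {vspace W};
  mor_maps : forall L, X L -> Y (mor_fun L);
  mor_cont : forall U, zopen Y U -> zopen X (fun L => X L /\ U (mor_fun L));
  mor_reg : forall U f, zopen Y U -> regular U f ->
    regular (fun L => X L /\ U (mor_fun L)) (fun L => f (mor_fun L)) }.

Arguments mor_maps {F V W X Y} m [L].
Arguments mor_cont {F V W X Y} m [U].
Arguments mor_reg {F V W X Y} m [U f].

Definition is_iso (F : fieldType) (V W : vectType F)
    (X : {vspace V} -> Prop) (Y : {vspace W} -> Prop) (phi : morphism X Y) : Prop :=
  exists psi : morphism Y X,
    (forall L, X L -> psi (phi L) = L) /\ (forall L, Y L -> phi (psi L) = L).

Section Inclusion.
Variables (F : fieldType) (V : vectType F) (X Y : {vspace V} -> Prop).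
Context (sXY : forall L, X L -> Y L).

Fact incl_cont U : zopen Y U -> zopen X (fun L => X L /\ U L).
Proof.
move=> [Z [cZ EZ]]; exists Z; split=> // L; rewrite EZ.
by split=> [[XL []]|[XL nZ]]; do ?split=> //; exact: sXY.
Qed.

Fact incl_reg U f : zopen Y U -> regular U f -> regular (fun L => X L /\ U L) f.
Proof.
move=> _ rf L [XL /rf [W [d [p [q [[Z [cZ EZ]] WL hp hq HW]]]]]].
exists (fun L => (X L /\ U L) /\ W L), d, p, q; split=> //.
- exists Z; split=> // L'; rewrite EZ.
  by split=> [[[? ?] []]|[[? ?] ?]]; do ?split.
- by have [] := (EZ L).1 WL.
- by move=> L' v [_]; exact: HW.
Qed.

Definition incl : morphism X Y := Morphism sXY incl_cont incl_reg.

End Inclusion.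

(* A line bundle on X, given by a trivializing open cover and transition      *)
(* functions: its sections are the families of functions s_i on the U_i with  *)
(* s_i = g_ij s_j.                                                            *)
Record line_bundle (F : fieldType) (V : vectType F) (X : {vspace V} -> Prop) :=
  LineBundle {
  lb_idx : Type;
  lb_dom : lb_idx -> {vspace V} -> Prop;
  lb_trans : lb_idx -> lb_idx -> {vspace V} -> F;
  lb_open : forall i, zopen X (lb_dom i);
  lb_cover : forall L, X L -> exists i, lb_dom i L;
  lb_reg : forall i j,
    regular (fun L => lb_dom i L /\ lb_dom j L) (lb_trans i j);
  lb_neq0 : forall i j L, lb_dom i L -> lb_dom j L -> lb_trans i j L != 0;
  lb_cocycle : forall i j k L, lb_dom i L -> lb_dom j L -> lb_dom k L ->
    lb_trans i j L * lb_trans j k L = lb_trans i k L }.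

Arguments lb_open {F V X} l i.
Arguments lb_cover {F V X} l [L].
Arguments lb_reg {F V X} l i j.
Arguments lb_neq0 {F V X} l [i j L].
Arguments lb_cocycle {F V X} l [i j k L].

Definition lb_iso (F : fieldType) (V : vectType F) (X : {vspace V} -> Prop)
    (E E' : line_bundle X) : Prop :=
  exists h : lb_idx E' -> lb_idx E -> {vspace V} -> F,
    [/\ forall k i, regular (fun L => lb_dom k L /\ lb_dom i L) (h k i),
        forall k i L, lb_dom k L -> lb_dom i L -> h k i L != 0 &
        forall k l i j L, lb_dom k L -> lb_dom l L -> lb_dom i L -> lb_dom j L ->
          h k i L * lb_trans i j L = lb_trans k l L * h l j L].

Section Pullback.
Variables (F : fieldType) (V W : vectType F).
Variables (X : {vspace V} -> Prop) (Y : {vspace W} -> Prop).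
Variables (phi : morphism X Y) (E : line_bundle Y).

Let dom (i : lb_idx E) L := X L /\ lb_dom i (phi L).
Let trans (i j : lb_idx E) L := lb_trans i j (phi L).

Fact pullback_open i : zopen X (dom i).
Proof. exact/mor_cont/lb_open. Qed.

Fact pullback_cover L : X L -> exists i, dom i L.
Proof. by move=> XL; have [i iL] := lb_cover E (mor_maps phi XL); exists i. Qed.

Fact pullback_reg i j : regular (fun L => dom i L /\ dom j L) (trans i j).
Proof.
have := mor_reg phi (zopenI (lb_open E i) (lb_open E j)) (lb_reg E i j).
congr regular.
by apply/funext => L; apply/propext; rewrite /dom; intuition.
Qed.

Fact pullback_neq0 i j L : dom i L -> dom j L -> trans i j L != 0.
Proof. by move=> [_ ?] [_ ?]; exact: lb_neq0. Qed.

Fact pullback_cocycle i j k L : dom i L -> dom j L -> dom k L ->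
  trans i j L * trans j k L = trans i k L.
Proof. by move=> [_ ?] [_ ?] [_ ?]; exact: lb_cocycle. Qed.

Definition pullback : line_bundle X :=
  LineBundle pullback_open pullback_cover pullback_reg pullback_neq0
    pullback_cocycle.

End Pullback.

(* O(d) on P(V), trivialized on U_l = {l <> 0} for each linear form l; e.g. a *)
(* global section xi of O(1), i.e. a linear form, is the family xi / l.       *)
Section Twist.
Variables (F : fieldType) (V : vectType F) (d : int).

Let dom (l : 'Hom(V, F^o)) (L : {vspace V}) : Prop := PP L /\ l (vpick L) != 0.
Let trans (l l' : 'Hom(V, F^o)) (L : {vspace V}) : F :=
  (l' (vpick L) / l (vpick L)) ^ d.

Definition mpoly_of_form (l : 'Hom(V, F^o)) : {mpoly F[\dim {:V}]} :=
  \sum_(i < \dim {:V}) (l (vbasis {:V})`_i : F) *: 'X_i.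

Lemma mpoly_of_form_homog l : mpoly_of_form l \is 1.-homog.
Proof. by apply: rpred_sum => i _; apply: rpredZ; rewrite dhomogX /= mdeg1. Qed.

Lemma hev_form l v : hev (mpoly_of_form l) v = l v.
Proof.
rewrite /hev raddf_sum /= {2}(coord_vbasis (memvf v)) linear_sum /=.
by apply: eq_bigr => i _; rewrite mevalZ mevalXU linearZ /= mulrC.
Qed.

Lemma twist_ratio (l l' : 'Hom(V, F^o)) (L : {vspace V}) v : PP L -> v \in L -> v != 0 ->
  (l' (vpick L) / l (vpick L) : F) = l' v / l v.
Proof.
move=> PL vL v0; have := PP_vpick PL.
have [c ->] := PP_scale PL vL v0 (memv_pick L).
rewrite scaler_eq0 negb_or => /andP[c0 _].
by rewrite !linearZ /= -mulf_div divff ?mul1r.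
Qed.

Fact twist_open l : zopen (@PP F V) (dom l).
Proof.
exists (fun L => PP L /\ vanishes_on (mpoly_of_form l) L).
split=> [|L]; first exact: zclosed_vanish (mpoly_of_form_homog l).
split=> -[PL H]; split=> //.
  move=> [_ /(_ _ (memv_pick L))]; rewrite hev_form => l0.
  by rewrite l0 eqxx in H.
apply/eqP => l0; apply: H; split=> // v vL.
have [c ->] := PP_scale PL (memv_pick L) (PP_vpick PL) vL.
by rewrite hev_form linearZ /= l0 scaler0.
Qed.

Fact twist_cover L : PP L -> exists l, dom l L.
Proof.
move=> PL; have v0 := PP_vpick PL.
have [i ci] : exists i, coord (vbasis {:V}) i (vpick L) != 0.
  apply/existsP; apply: contraNT v0; rewrite negb_exists => /forallP H.
  rewrite (coord_vbasis (memvf (vpick L))) big1 // => i _.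
  by have := H i; rewrite negbK => /eqP ->; rewrite scale0r.
by exists (linfun (coord (vbasis {:V}) i : V -> F^o)); split; rewrite // lfunE.
Qed.

Fact twist_reg l l' : regular (fun L => dom l L /\ dom l' L) (trans l l').
Proof.
move=> L lL; exists (fun L => dom l L /\ dom l' L).
have hX (p : 'Hom(V, F^o)) k : mpoly_of_form p ^+ k \is k.-homog.
  by have := dhomogMn k (mpoly_of_form_homog p); rewrite mul1n.
have hE (p : 'Hom(V, F^o)) k v : hev (mpoly_of_form p ^+ k) v = (p v : F) ^+ k.
  by rewrite -hev_form /hev rmorphXn.
case dE : d => [k|k].
  exists k, (mpoly_of_form l' ^+ k), (mpoly_of_form l ^+ k).
  split=> //; first exact: zopenxx.
  move=> L' v [[PL lL'] _] vL' v0; rewrite !hE.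
  have [c E] := PP_scale PL vL' v0 (memv_pick L').
  split; first by apply: expf_neq0; apply: contraNneq lL' => lv; rewrite E linearZ /= lv scaler0.
  by rewrite /trans (twist_ratio _ _ PL vL' v0) dE -exprnP expr_div_n.
exists k.+1, (mpoly_of_form l ^+ k.+1), (mpoly_of_form l' ^+ k.+1).
split=> //; first exact: zopenxx.
move=> L' v [_ [PL lL']] vL' v0; rewrite !hE.
have [c E] := PP_scale PL vL' v0 (memv_pick L').
split; first by apply: expf_neq0; apply: contraNneq lL' => lv; rewrite E linearZ /= lv scaler0.
by rewrite /trans (twist_ratio _ _ PL vL' v0) dE NegzE -exprnN -exprVn invf_div expr_div_n.
Qed.

Fact twist_neq0 l l' L : dom l L -> dom l' L -> trans l l' L != 0.
Proof. by move=> [_ lL] [_ l'L]; apply: expfz_neq0; rewrite mulf_neq0 ?invr_neq0. Qed.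

Fact twist_cocycle l1 l2 l3 L : dom l1 L -> dom l2 L -> dom l3 L ->
  trans l1 l2 L * trans l2 l3 L = trans l1 l3 L.
Proof.
move=> _ [_ l2L] _; rewrite /trans -expfzMl mulf_div.
by rewrite [X in X / _]mulrC -mulf_div divff ?mulr1.
Qed.

Definition twist : line_bundle (@PP F V) :=
  LineBundle twist_open twist_cover twist_reg twist_neq0 twist_cocycle.

End Twist.

Section FusionProduct.
Variables (F : fieldType) (n : nat).

(* sl_2 is the space of traceless 2 x 2 matrices, with e = delta_mx 0 1,      *)
(* f = delta_mx 1 0 and h = e f - f e.                                        *)

(* The a-dimensional irreducible module has a basis u_0, ..., u_(a-1), with   *)
(* u_0 of lowest weight, e u_j = u_(j+1), h u_j = (2 j - (a - 1)) u_j and     *)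
(* f u_j = j (a - j) u_(j-1).                                                 *)
Definition irr_e a : 'M[F]_a := \matrix_(i, j) (i == j.+1 :> nat)%:R.
Definition irr_h a : 'M[F]_a :=
  \matrix_(i, j) ((j.*2%:R - a.-1%:R) *+ (i == j)).
Definition irr_f a : 'M[F]_a :=
  \matrix_(i, j) ((j * (a - j))%:R *+ (j == i.+1 :> nat)).
Definition irr a (x : 'M[F]_2) : 'M[F]_a :=
  x 0 1 *: irr_e a + x 0 0 *: irr_h a + x 1 0 *: irr_f a.

Variables (a : 'I_n -> nat) (z : 'I_n -> F).

(* The tensor product of the C^(a_l): u m is the coordinate of u on the       *)
(* tensor product of the basis vectors u_(m l).                               *)
Definition tensor := {ffun {dffun forall l : 'I_n, 'I_(a l)} -> F^o}.

Definition on_factor l (X : 'M[F]_(a l)) (u : tensor) : tensor :=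
  [ffun m : {dffun forall l : 'I_n, 'I_(a l)} =>
     \sum_(k < a l) X (m l) k * u (finfun (dfwith m k))].

(* the action of x_j = x (x) t^j on the tensor product of the C^(a_l)(z_l) *)
Definition cur (x : 'M[F]_2) (j : nat) (u : tensor) : tensor :=
  \sum_l z l ^+ j *: on_factor (irr (a l) x) u.

Definition lowest : tensor :=
  [ffun m : {dffun forall l : 'I_n, 'I_(a l)} => [forall l, m l == 0%N :> nat]%:R].

Definition monomial (xs : seq ('M[F]_2 * nat)) : tensor :=
  foldr (fun xj => cur xj.1 xj.2) lowest xs.

(* Fil s is F_s, and Fil_pred s is F_(s-1). *)
Definition Fil (s : nat) (u : tensor) : Prop :=
  exists ws : seq tensor, u \in <<ws>>%VS /\
    forall w, w \in ws -> exists xs : seq ('M[F]_2 * nat),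
      [/\ w = monomial xs, forall xj, xj \in xs -> \tr xj.1 = 0 &
          (sumn (map snd xs) <= s)%N].

Definition Fil_pred (s : nat) (u : tensor) : Prop :=
  if s is s'.+1 then Fil s' u else u = 0.

(* A realization of the associated graded module: fus_cls s maps u in F_s to  *)
(* its class in F_s / F_(s-1) (its values outside F_s are irrelevant), and    *)
(* fus_space is the direct sum of the images of the F_s.                      *)
Record fusion := Fusion {
  fus_space : vectType F;
  fus_cls : nat -> 'Hom(tensor, fus_space);
  fus_act : 'M[F]_2 -> nat -> 'End(fus_space);
  fus_ker : forall s u, Fil s u -> (fus_cls s u = 0 <-> Fil_pred s u);
  fus_span : forall m : fus_space, exists N (u : nat -> tensor),
    (forall s, Fil s (u s)) /\ m = \sum_(s < N) fus_cls s (u s);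
  fus_direct : forall N (u : nat -> tensor), (forall s, Fil s (u s)) ->
    \sum_(s < N) fus_cls s (u s) = 0 ->
    forall s, (s < N)%N -> fus_cls s (u s) = 0;
  fus_actE : forall x j s u, \tr x = 0 -> Fil s u ->
    fus_act x j (fus_cls s u) = fus_cls (s + j)%N (cur x j u) }.

End FusionProduct.

Lemma vspace_of (F : fieldType) (V : vectType F) (P : V -> Prop) :
  P 0 -> (forall c u v, P u -> P v -> P (c *: u + v)) ->
  exists W : {vspace V}, forall u, u \in W <-> P u.
Proof.
move=> P0 PL.
pose Q k := `[< exists W : {vspace V}, \dim W = k /\ forall u, u \in W -> P u >].
have exQ : exists k, Q k.
  exists 0%N; apply/asboolP; exists 0%VS; rewrite dimv0; split=> // u.
  by rewrite memv0 => /eqP ->.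
have ubQ k : Q k -> (k <= \dim {:V})%N.
  by move=> /asboolP[W [<- _]]; exact/dimvS/subvf.
case: (ex_maxnP exQ ubQ) => k /asboolP[W [dW WP]] max.
exists W => u; split=> [|Pu]; first exact: WP.
apply: contrapT => /negP uW.
have : Q (\dim (<[u]> + W)%VS).
  apply/asboolP; exists (<[u]> + W)%VS; split=> // w.
  by move=> /memv_addP[_ /vlineP[c ->] [w' /WP Pw' ->]]; exact: PL.
move=> /max; rewrite -dW => le.
have /eqP E : W == (<[u]> + W)%VS by rewrite eqEdim addvSr le.
by rewrite E memvE addvSl in uW.
Qed.

Section FusionExists.
Variables (F : fieldType) (n : nat) (a : 'I_n -> nat) (z : 'I_n -> F).
Local Notation T := (tensor F a).

Lemma cur_linear x j : linear (cur z x j : T -> T).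
Proof.
move=> c u v; apply/ffunP => m; rewrite /cur scaler_sumr -big_split /=.
rewrite !sum_ffunE; apply: eq_bigr => l _.
rewrite !ffunE -!/(GRing.scale _ _) -[_ *: (_ *: _)]/(_ * (_ * _)).
rewrite -![_ *: (_ : F^o)]/(_ * _) mulrCA -mulrDr; congr (_ * _).
rewrite mulr_sumr -big_split /=; apply: eq_bigr => k _.
rewrite !ffunE -[_ *: (_ : F^o)]/(_ * _); rewrite mulrDr; congr (_ + _).
by rewrite mulrCA.
Qed.

HB.instance Definition _ x j := GRing.isLinear.Build F T T _ (cur z x j) (cur_linear x j).

Definition Cur x j : 'End(T) := linfun (cur z x j).

Lemma Fil0 s : Fil z s (0 : T).
Proof. by exists [::]; rewrite span_nil mem0v; split. Qed.

Lemma FilL s c (u v : T) : Fil z s u -> Fil z s v -> Fil z s (c *: u + v).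
Proof.
move=> [ws [uw H]] [ws' [vw H']]; exists (ws ++ ws'); split.
  by rewrite span_cat memv_add // memvZ.
by move=> w; rewrite mem_cat => /orP[/H|/H'].
Qed.

Lemma Fil_mono s s' (u : T) : (s <= s')%N -> Fil z s u -> Fil z s' u.
Proof.
move=> ss [ws [uw H]]; exists ws; split=> // w /H [xs [? ? le]].
by exists xs; split=> //; exact: leq_trans le ss.
Qed.

Lemma Fil_cur x j s (u : T) : \tr x = 0 -> Fil z s u -> Fil z (s + j) (cur z x j u).
Proof.
move=> trx [ws [uw H]]; exists (map (Cur x j) ws); split.
  by rewrite -limg_span -(lfunE (cur z x j)) memv_img.
move=> _ /mapP[w /H [xs [-> tx le]] ->]; exists ((x, j) :: xs); split.
- by rewrite lfunE.
- by move=> xj; rewrite inE => /orP[/eqP ->|/tx].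
- by rewrite /= addnC leq_add2r.
Qed.

Lemma fusion_exists : inhabited (fusion a z).
Proof.
have [FV FVP] : {FV : nat -> {vspace T} & forall s u, u \in FV s <-> Fil z s u}.
  apply: (@choice _ _ (fun s (W : {vspace T}) => forall u, u \in W <-> Fil z s u)).
  by move=> s; apply: vspace_of; [exact: Fil0|exact: FilL].
pose FP s : {vspace T} := if s is s'.+1 then FV s' else 0%VS.
have FPP s u : u \in FP s <-> Fil_pred z s u.
  by case: s => [|s] //=; rewrite memv0; split=> [/eqP|->].
have FPV s : (FP s <= FV s)%VS.
  case: s => [|s]; rewrite ?sub0v //; apply/subvP => u /FVP Fu; apply/FVP.
  exact: Fil_mono Fu.
have FVmono s s' : (s <= s')%N -> (FV s <= FV s')%VS.
  by move=> ss; apply/subvP => u /FVP Fu; apply/FVP; exact: Fil_mono Fu.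
have [S ST] : exists S, forall s, (S < s)%N -> FP s = FV s.
  have exd : exists k, `[< exists s, \dim (FV s) = k >].
    by exists (\dim (FV 0)); apply/asboolP; exists 0%N.
  have ubd k : `[< exists s, \dim (FV s) = k >] -> (k <= \dim {:T})%N.
    by move=> /asboolP[s <-]; exact/dimvS/subvf.
  case: (ex_maxnP exd ubd) => k /asboolP[S dS] max; exists S => -[//|s] lt /=.
  apply/eqP; rewrite eqEdim FVmono //=.
  apply: leq_trans (_ : \dim (FV S) <= _)%N; last by apply/dimvS/FVmono.
  by rewrite dS; apply: max; apply/asboolP; exists s.+1.
pose pr s : 'End(T) := addv_pi1 (FV s) (FP s).
have prF s u : Fil z s u -> Fil_pred z s (u - pr s u).
  move=> /FVP uF; apply/FPP.
  have uS : u \in (FV s + FP s)%VS by rewrite (subvP (addvSl _ _)).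
  by rewrite -{1}(addv_pi1_pi2 uS) addrC addKr memv_pi2.
have prV s u : u \in FP s -> pr s u = 0.
  move=> uF; have uS : u \in (FV s + FP s)%VS by rewrite (subvP (addvSr _ _)).
  have := addv_pi1_pi2 uS; rewrite addv_pi2_id // => /(canRL (addrK _)).
  by rewrite subrr.
have prm s u : pr s u \in (FV s :\: FP s)%VS by exact: memv_pi.
have prD s u : u \in (FV s :\: FP s)%VS -> pr s u = u.
  by move=> uD; rewrite /pr /addv_pi1 daddv_pi_id // capv_diff.
pose B := {ffun 'I_S.+1 -> T}.
have [W WP] : exists W : {vspace B}, forall m, m \in W <->
    (forall k : 'I_S.+1, (m : B) k \in (FV k :\: FP k)%VS).
  apply: vspace_of => [k|c u v Hu Hv k]; first by rewrite ffunE mem0v.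
  by rewrite !ffunE rpredD // rpredZ.
pose inj s (u : T) : B := [ffun k : 'I_S.+1 => if s == k :> nat then pr s u else 0].
have injW s u : inj s u \in W.
  apply/WP => k; rewrite ffunE; case: eqP => [->|_]; [exact: prm|exact: mem0v].
have inj_lin s : linear (inj s).
  move=> c u v; apply/ffunP => k; rewrite !ffunE; case: eqP => _.
    by rewrite linearP.
  by rewrite scaler0 addr0.
pose injL s : 'Hom(T, B) :=
  linfun (HB.pack (inj s) (GRing.isLinear.Build F T B _ (inj s) (inj_lin s)) : {linear T -> B}).
have injLE s u : injL s u = inj s u by rewrite lfunE.
pose M : vectType F := subvs_of W.
have [cls clsE] : {cls : nat -> 'Hom(T, M) | forall s u, vsval (cls s u) = inj s u}.
  exists (fun s => (linfun (vsproj W) \o injL s)%VF) => s u.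
  by rewrite comp_lfunE lfunE injLE /= vsprojK.
have comp_lin (k : 'I_S.+1) : linear (fun m : M => (vsval m : B) k : T).
  by move=> c u v; rewrite linearP !ffunE.
have [comp compE] : {comp : 'I_S.+1 -> 'Hom(M, T) | forall k m, comp k m = (vsval m : B) k}.
  exists (fun k => linfun (HB.pack (fun m : M => (vsval m : B) k : T)
     (GRing.isLinear.Build F M T _ _ (comp_lin k)) : {linear M -> T})) => k m.
  by rewrite lfunE.
have cls0 s u : Fil z s u -> (cls s u = 0 <-> Fil_pred z s u).
  move=> Fu; split=> [c0|/FPP uF].
    have [sS|Ss] := leqP s S; last by apply/FPP; rewrite ST //; apply/FVP.
    have := congr1 (fun m : M => (vsval m : B) (inord s)) c0.
    rewrite clsE ffunE inordK // eqxx linear0 ffunE => pr0.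
    by have := prF _ _ Fu; rewrite pr0 subr0.
  apply: val_inj; rewrite /= clsE ?linear0; apply/ffunP => k; rewrite !ffunE.
  by case: ifP => // _; rewrite prV.
pose act x j : 'End(M) := \sum_(k < S.+1) (cls (k + j)%N \o (Cur x j \o comp k))%VF.
constructor; apply: (@Fusion F n a z M cls act cls0).
- move=> m; exists S.+1, (fun s => if (s <= S)%N then (vsval m : B) (inord s) else 0); split.
    move=> s; case: leqP => [sS|_]; last exact: Fil0.
    apply/FVP; have /WP/(_ (inord s)) := subvsP m.
    by rewrite inordK // => /(subvP (diffvSl _ _)).
  apply: val_inj; rewrite /= linear_sum /=; apply/ffunP => k.
  rewrite sum_ffunE (bigD1 k) //= big1 ?addr0 => [|l lk].
    rewrite clsE ffunE eqxx -ltnS ltn_ord inord_val prD //.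
    by have /WP/(_ k) := subvsP m.
  by rewrite clsE ffunE (negbTE (lk : (l : nat) != k)).
- move=> N u Fu s0 s sN.
  have [sS|Ss] := leqP s S; last first.
    by apply/(cls0 _ _ (Fu s)); apply/FPP; rewrite ST //; apply/FVP.
  apply: val_inj; rewrite /= clsE ?linear0; apply/ffunP => k; rewrite !ffunE.
  case: eqP => // sk.
  have := congr1 (fun m : M => (vsval m : B) k) s0.
  rewrite linear_sum /= sum_ffunE ffunE (bigD1 (Ordinal sN)) //= big1.
    by rewrite addr0 clsE ffunE sk eqxx.
  move=> l /eqP lk; rewrite clsE ffunE; case: eqP => // E.
  by case: lk; apply: val_inj; rewrite /= E.
- move=> x j s u trx Fu; rewrite sum_lfunE.
  have F2 : Fil z (s + j) (cur z x j u) by exact: Fil_cur.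
  have cur_pred v : Fil_pred z s v -> cls (s + j)%N (cur z x j v) = 0.
    case: (s) => [->|s' Fv]; first by rewrite !linear0.
    apply/cls0; last by rewrite addSn /=; exact: Fil_cur.
    by apply: Fil_mono (Fil_cur j trx Fv); rewrite leq_add2r.
  have [sS|Ss] := leqP s S.
    rewrite (bigD1 (Ordinal (sS : (s < S.+1)%N))) //= big1 ?addr0.
      rewrite !comp_lfunE compE clsE ffunE eqxx.
      have := cur_pred _ (prF _ _ Fu); rewrite !linearB /= => /eqP.
      by rewrite subr_eq0 => /eqP ->; congr (cls _ _); rewrite lfunE.
    move=> l /eqP lk; rewrite !comp_lfunE compE clsE ffunE; case: eqP => [E|_].
      by case: lk; apply: val_inj.
    by rewrite !linear0.
  have uP : Fil_pred z s u by apply/FPP; rewrite ST //; apply/FVP.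
  rewrite (cur_pred _ uP) big1 // => k _.
  have /(cls0 _ _ Fu) -> := uP; by rewrite !comp_lfunE !linear0.
Qed.
End FusionExists.

(* exp N for a nilpotent N *)
Definition nexp (F : fieldType) (V : vectType F) (N : 'End(V)) (v : V) : V :=
  \sum_(k < (\dim {:V}).+1) k`!%:R^-1 *: iter k N v.

Section Schubert.
Variables (F : fieldType) (n : nat) (a : 'I_n -> nat) (z : 'I_n -> F).
Variable M : fusion a z.

Let e : 'M[F]_2 := delta_mx 0 1.
Let f : 'M[F]_2 := delta_mx 1 0.

Definition fus_vec : fus_space M := fus_cls M 0 (lowest F a).

Local Notation "'Ct" := {poly %/ ('X^n : {poly F})} (at level 0).

(* the action of x (x) p for p in C[t]/t^n *)
Definition fus_cur (x : 'M[F]_2) (p : 'Ct) : 'End(fus_space M) :=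
  \sum_(j < n) (p : {poly F})`_j *: fus_act M x j.

(* The action of G = SL_2(C[t]/t^n) on M: g maps v to w.  As C[t]/t^n is      *)
(* local, G is generated by the elementary matrices exp(p e) = 1 + p e and    *)
(* exp(p f) = 1 + p f.                                                        *)
Inductive Gact : 'M['Ct]_2 -> fus_space M -> fus_space M -> Prop :=
| Gact1 v : Gact 1%:M v v
| Gact_e g v w p : Gact g v w ->
    Gact ((1%:M + p *: delta_mx 0 1) *m g) v (nexp (fus_cur e p) w)
| Gact_f g v w p : Gact g v w ->
    Gact ((1%:M + p *: delta_mx 1 0) *m g) v (nexp (fus_cur f p) w).

Definition sh : {vspace fus_space M} -> Prop :=
  zclosure (fun L => exists g w, [/\ \det g = 1, Gact g fus_vec w & L = <[w]>%VS]).

Definition curve (i : 'I_n) : {vspace fus_space M} -> Prop :=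
  zclosure (fun L => exists tau : F,
    L = <[nexp (tau *: fus_act M e i) fus_vec]>%VS).

Lemma fus_cur_monomial x (i : 'I_n) tau :
  fus_cur x (in_qpoly 'X^n (tau *: 'X^i)) = tau *: fus_act M x i.
Proof.
have coefE (j : nat) :
    (in_qpoly 'X^n (tau *: 'X^i) : {poly F})`_j = tau * (j == i)%:R.
  have n0 : (0 < n)%N by exact: leq_ltn_trans (ltn_ord i).
  rewrite in_qpoly_small ?coefZ ?coefXn //.
  rewrite /mk_monic size_polyXn ltnS n0 monicXn /= (size_polyXn _ n).
  by rewrite (leq_ltn_trans (size_scale_leq _ _)) // size_polyXn !ltnS.
rewrite /fus_cur (bigD1 i) //= big1 => [|j ji].
  by rewrite coefE eqxx mulr1 addr0.
by rewrite coefE (negbTE (ji : (j : nat) != i)) mulr0 scale0r.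
Qed.

Lemma curve_sub i L : curve i L -> sh L.
Proof.
apply: zclosure_mono => {}L [tau ->].
exists ((1%:M + in_qpoly 'X^n (tau *: 'X^i) *: delta_mx 0 1) *m 1%:M).
eexists; split; last by rewrite -fus_cur_monomial.
  rewrite mulmx1 -det_tr det_trig.
    by rewrite !big_ord_recl big_ord0 !mxE /= !mulr0 !addr0 !mulr1.
  apply/is_trig_mxP => k l; rewrite !mxE.
  by case: k l => [[|[|]]] // ? [[|[|]]] //= ? _; rewrite mulr0 addr0.
by apply: Gact_e; exact: Gact1.
Qed.

End Schubert.

Arguments fus_vec {F n a z} M.
Arguments sh {F n a z} M L.
Arguments curve {F n a z} M i L.
Arguments curve_sub {F n a z} M i [L].

(* E is O(c_1, ..., c_n), where c_(j+1) is c j: a line bundle on sh^(n) being *)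
(* determined by its restrictions to the lines C_i, O(c_1, ..., c_n) is       *)
(* defined as the one restricting to O(c_1 + ... + c_(n-i)) on each C_i.      *)
Definition is_O (F : fieldType) (n : nat) (a : 'I_n -> nat) (z : 'I_n -> F)
    (M : fusion a z) (E : line_bundle (sh M)) (c : 'I_n -> int) : Prop :=
  forall i : 'I_n, exists phi : morphism (@PP F 'rV[F]_2) (curve M i),
    is_iso phi /\
    lb_iso (pullback phi (pullback (incl (curve_sub M i)) E))
           (twist _ (\sum_(j < n | (j < n - i)%N) c j)).

(* iota is the embedding of sh_B = sh^(n) in P(M^A) with image sh_A: the      *)
(* canonical G-equivariant one, that maps [v_B] to [v_A].                     *)
Definition realizes (F : fieldType) (n : nat) (a b : 'I_n -> nat)
    (za zb : 'I_n -> F) (MA : fusion a za) (MB : fusion b zb)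
    (iota : morphism (sh MB) (@PP F (fus_space MA))) : Prop :=
  (exists j : morphism (sh MB) (sh MA),
     is_iso j /\ forall L, sh MB L -> iota L = j L) /\
  (forall g w w', Gact g (fus_vec MB) w -> Gact g (fus_vec MA) w' ->
     iota <[w]>%VS = <[w']>%VS).

(* Main.v *)
Require Import Defs.
From HB Require Import structures.
From mathcomp Require Import all_boot all_order all_algebra.
From mathcomp Require Import perm mpoly complex reals boolp zify ring.

Set Implicit Arguments.
Unset Strict Implicit.
Unset Printing Implicit Defensive.

Import Order.TTheory GRing.Theory Num.Theory.
Local Open Scope ring_scope.

(* Write N_A(i) for the largest k with e_i^k v_A <> 0.  The curve C_i is the  *)
(* rational normal curve of degree N_B(i) spanned by the e_i^k v_B, it is     *)
(* parametrized by P^1, and iota_A maps the point exp(tau e_i) v_B to         *)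
(* exp(tau e_i) v_A, so that O(1) pulls back to O(N_A(i)) on P^1.  It remains *)
(* to see that N_A(i) = sum_(l < n - i) (a_l - 1).                            *)
(*                                                                            *)
(* The tensor product is C[x_1, ..., x_n] / (x_l^(a_l)) with                  *)
(* e_j = sum_l z_l^j x_l, and the commutation relations reduce F_s to the     *)
(* monomials in the e_j.  Modulo e_0, ..., e_(i-1), e_i is a combination of   *)
(* the x_l with l < n - i, which gives the upper bound.  For the lower bound, *)
(* a polynomial P of degree < a_l in each X_l defines a functional            *)
(* Q |-> (Q(d/dX) P)(0) on the tensor product; we need P homogeneous of       *)
(* degree k such that it kills e_(j_1) ... e_(j_k) if sum_p j_p < i k but not *)
(* e_i^k.  For N factors C^2, k = N - i and P is the determinant of the       *)
(* N x N matrix with rows (z_m^p)_m, p < i, and (z_m^(p-i) X_m)_m, p >= i:    *)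
(* each e_j raises one exponent by j, a Vandermonde-like determinant with     *)
(* exponents of sum < 0 + ... + (N - 1) vanishes, and e_i^k restores the      *)
(* Vandermonde determinant.  In general P is the product over t of these      *)
(* polynomials for the factors with t < a_l - 1.                              *)

(** By definition of [is_O], the claim is that O(1), pulled back along the composite P^1 -> C_i ->
    sh_B -> P(M^A), is O(D) with D = sum_(l < n - i) (a_l - 1), indices starting at 0. If D is the
    last exponent with e_i^D v_A <> 0, the vectors e_i^k v_A / k! for k <= D are free, and exp(tau
    e_i) v_A runs through the affine part of the rational normal curve they span ([nexp_nrc]).
    [realizes] gives the composite at the points exp(tau e_i) v_B only; [agree_on_affine] extends it
    to the limit tau = infinity, and [lb_iso_twist] reads off the degree D. That C_i itself is P^1
    is [nrc_iso], applied to B.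

    What remains is algebra in the tensor product: e_i^t v_A vanishes in the graded module exactly
    when e_i^t of the lowest vector lies in F_(i t - 1). [iter_cure_upper] proves this for t = D + 1
    and [iter_cure_lower] refutes it for t = D; the latter rests on [Fil_espan], which reduces F_s
    to monomials in the e_j, and on the test polynomial of [lower_witness]. *)

Section CurrentAction.
Variables (F : fieldType) (n : nat) (a : 'I_n -> nat) (z : 'I_n -> F).
Local Notation T := (tensor F a).
Local Notation index := {dffun forall l : 'I_n, 'I_(a l)}.
Implicit Types (X Y : forall l, 'M[F]_(a l)) (u v : T) (m : index).

Definition mset m l (k : 'I_(a l)) : index := finfun (dfwith m k).

Lemma mset_in m l (k : 'I_(a l)) : mset m k l = k.
Proof. by rewrite ffunE dfwith_in. Qed.

Lemma mset_out m l (k : 'I_(a l)) l' : l != l' -> mset m k l' = m l'.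
Proof. by move=> ll'; rewrite ffunE dfwith_out. Qed.

Lemma mset_eq m m' l : (forall l', l != l' -> m l' = m' l') -> mset m (m' l) = m'.
Proof.
move=> E; apply/ffunP => l'; have [<-|ll'] := eqVneq l l'; first by rewrite mset_in.
by rewrite mset_out ?E.
Qed.

Lemma mset_mset m l (k k' : 'I_(a l)) : mset (mset m k) k' = mset m k'.
Proof.
apply/ffunP => l'; have [<-|ll'] := eqVneq l l'; first by rewrite !mset_in.
by rewrite !mset_out.
Qed.

Lemma mset_comm m l l' (k : 'I_(a l)) (k' : 'I_(a l')) : l != l' ->
  mset (mset m k) k' = mset (mset m k') k.
Proof.
move=> ll'; apply/ffunP => r.
have [<-|lr] := eqVneq l r; first by rewrite mset_in mset_out 1?eq_sym // mset_in.
have [<-|l'r] := eqVneq l' r; first by rewrite mset_in mset_out // mset_in.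
by rewrite !mset_out.
Qed.

Lemma on_factorE l (A : 'M[F]_(a l)) u m :
  on_factor A u m = \sum_k A (m l) k * u (mset m k).
Proof. by rewrite ffunE. Qed.

Lemma on_factor_linear l (A : 'M[F]_(a l)) : linear (on_factor A : T -> T).
Proof.
move=> c u v; apply/ffunP => m; rewrite !ffunE -[_ *: (_ : F^o)]/(_ * _) mulr_sumr.
rewrite -big_split; apply: eq_bigr => k _ /=.
by rewrite !ffunE -[_ *: (_ : F^o)]/(_ * _) mulrDr mulrCA.
Qed.

HB.instance Definition _ l (A : 'M[F]_(a l)) :=
  GRing.isLinear.Build F T T _ (on_factor A) (on_factor_linear A).

Lemma on_factorM l (A B : 'M[F]_(a l)) u :
  on_factor A (on_factor B u) = on_factor (A *m B) u.
Proof.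
apply/ffunP => m; rewrite !on_factorE.
under eq_bigr => k _ do rewrite on_factorE mset_in mulr_sumr.
rewrite exchange_big; apply: eq_bigr => k _ /=; rewrite mxE mulr_suml.
by apply: eq_bigr => k' _; rewrite mset_mset mulrA.
Qed.

Lemma on_factor_comm l l' (A : 'M[F]_(a l)) (B : 'M[F]_(a l')) u : l != l' ->
  on_factor A (on_factor B u) = on_factor B (on_factor A u).
Proof.
move=> ll'; apply/ffunP => m; rewrite !on_factorE.
under eq_bigr => k _ do rewrite on_factorE mulr_sumr.
under [RHS]eq_bigr => k _ do rewrite on_factorE mulr_sumr.
rewrite exchange_big; apply: eq_bigr => k _ /=; apply: eq_bigr => k' _.
by rewrite mulrCA mset_comm // !mset_out // eq_sym.
Qed.

Lemma on_factor_sumE l c (A B : 'M[F]_(a l)) u :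
  on_factor (c *: A + B) u = c *: on_factor A u + on_factor B u.
Proof.
apply/ffunP => m; rewrite !ffunE -[_ *: (_ : F^o)]/(_ * _) mulr_sumr -big_split.
by apply: eq_bigr => k _ /=; rewrite !mxE mulrDl mulrA.
Qed.

(* x (x) t^j acts by cura X j, where X l is the action of x on C^(a_l). *)
Definition cura X j u : T := \sum_l z l ^+ j *: on_factor (X l) u.

Lemma cura_linear X j : linear (cura X j).
Proof.
move=> c u v; rewrite scaler_sumr -big_split; apply: eq_bigr => l _ /=.
by rewrite linearP scalerDr !scalerA mulrC.
Qed.

HB.instance Definition _ X j := GRing.isLinear.Build F T T _ (cura X j) (cura_linear X j).

Lemma cura_comb c X Y j u :
  cura (fun l => c *: X l + Y l) j u = c *: cura X j u + cura Y j u.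
Proof.
rewrite scaler_sumr -big_split; apply: eq_bigr => l _ /=.
by rewrite on_factor_sumE scalerDr !scalerA mulrC.
Qed.

Lemma eq_cura X Y j u : (forall l, X l = Y l) -> cura X j u = cura Y j u.
Proof. by move=> E; apply: eq_bigr => l _; rewrite E. Qed.

(** Operators on different factors commute, so only the diagonal terms survive, and there z_l^i
    z_l^j = z_l^(i + j). *)
Lemma cura_comm X Y i j u :
  cura X i (cura Y j u) =
  cura Y j (cura X i u) + cura (fun l => X l *m Y l - Y l *m X l) (i + j) u.
Proof.
have E X' Y' i' j' : cura X' i' (cura Y' j' u) = \sum_l \sum_l'
    (z l ^+ i' * z l' ^+ j') *: on_factor (X' l) (on_factor (Y' l') u).
  apply: eq_bigr => l _; rewrite linear_sum scaler_sumr; apply: eq_bigr => l' _.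
  by rewrite linearZ scalerA.
rewrite E [X in _ = X + _]E [X in _ = X + _]exchange_big -big_split; apply: eq_bigr => l _ /=.
rewrite (bigD1 l) // [X in _ = X + _](bigD1 l) //=.
rewrite [X in _ + X = _](eq_bigr (fun l' => (z l' ^+ j * z l ^+ i) *:
    on_factor (Y l') (on_factor (X l) u))) => [|l' l'l]; last first.
  by rewrite mulrC on_factor_comm // eq_sym.
rewrite addrAC; congr (_ + _); rewrite !on_factorM exprD.
have -> : X l *m Y l - Y l *m X l = -1 *: (Y l *m X l) + X l *m Y l.
  by rewrite scaleN1r addrC.
by rewrite [z l ^+ j * _]mulrC on_factor_sumE scaleN1r scalerDr scalerN addrA subrr add0r.
Qed.

Lemma irr_he b : irr_h F b *m irr_e F b - irr_e F b *m irr_h F b = 2 *: irr_e F b.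
Proof.
apply/matrixP => i j; rewrite !mxE (bigD1 i) // big1 /= => [|k ki]; last first.
  by rewrite !mxE eq_sym (negbTE ki) mulr0n mul0r.
rewrite (bigD1 j) // big1 /= => [|k kj]; last by rewrite !mxE (negbTE kj) mulr0.
rewrite !mxE !eqxx !mulr1n !addr0 mulrC -mulrBr mulrC.
have [->|_] := eqVneq (i : nat) j.+1; last by rewrite !mulr0.
congr (_ * _); rewrite opprB addrA subrK doubleS -addn2 natrD.
by rewrite addrAC subrr add0r.
Qed.

Lemma irr_fe b : irr_f F b *m irr_e F b - irr_e F b *m irr_f F b = - irr_h F b.
Proof.
have fe i j : (irr_f F b *m irr_e F b) i j = ((j.+1 * (b - j.+1))%:R *+ (i == j)).
  rewrite mxE; have [jb|bj] := ltnP j.+1 b.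
    rewrite (bigD1 (Ordinal jb)) // big1 /= => [|k /eqP kj]; last first.
      rewrite !mxE; case: (k =P j.+1 :> nat) => [E|_]; last by rewrite mulr0.
      by case: kj; apply: val_inj.
    by rewrite !mxE /= eqxx mulr1 addr0 eqSS eq_sym.
  (* Here j is the top basis vector, killed by e; the formula persists because its coefficient
     vanishes. *)
  have -> : (b - j.+1 = 0)%N by apply/eqP; rewrite subn_eq0.
  rewrite muln0 mul0rn big1 // => k _; rewrite !mxE.
  by rewrite (ltn_eqF (leq_trans (ltn_ord k) bj)) mulr0.
have ef i j : (irr_e F b *m irr_f F b) i j = ((j * (b - j))%:R *+ (i == j)).
  rewrite mxE; case: (posnP j) => [j0|jp].
    rewrite j0 mul0n mul0rn big1 // => k _; rewrite !mxE j0.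
    by rewrite mulr0n mulr0.
  have jb : (j.-1 < b)%N by rewrite (leq_ltn_trans (leq_pred _)).
  rewrite (bigD1 (Ordinal jb)) // big1 /= => [|k /eqP kj]; last first.
    rewrite !mxE; case: (j =P k.+1 :> nat) => [E|_]; last by rewrite mulr0n mulr0.
    by case: kj; apply: val_inj; rewrite /= E.
  rewrite !mxE /= prednK // eqxx mulr1n addr0 mulrC.
  by rewrite -[i == j]/(i == j :> nat) mulr_natr.
apply/matrixP => i j; rewrite [LHS]mxE [X in _ + X]mxE fe ef !mxE.
have [_|_] := eqVneq i j; last by rewrite !mulr0n subrr oppr0.
rewrite !mulr1n opprB.
have jb := ltn_ord j; move: (j : nat) jb => k kb.
apply/eqP; rewrite subr_eq addrAC eq_sym subr_eq eq_sym -!natrD.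
apply/eqP; congr (_%:R); by nia.
Qed.

End CurrentAction.

(** * Reduction of F_s to monomials in the e_j, and the upper bound *)

Section LowestWeight.
Variables (F : fieldType) (n : nat) (a : 'I_n -> nat) (z : 'I_n -> F).
Local Notation T := (tensor F a).
Local Notation index := {dffun forall l : 'I_n, 'I_(a l)}.
Implicit Types (u v : T) (m : index) (js : seq nat).

Definition cure j : T -> T := cura z (fun l => irr_e F (a l)) j.
Definition curh j : T -> T := cura z (fun l => irr_h F (a l)) j.
Definition curf j : T -> T := cura z (fun l => irr_f F (a l)) j.

HB.instance Definition _ j := GRing.Linear.on (cure j).
HB.instance Definition _ j := GRing.Linear.on (curh j).
HB.instance Definition _ j := GRing.Linear.on (curf j).

Lemma cur_efh x j u :
  cur z x j u = x 0 1 *: cure j u + (x 0 0 *: curh j u + x 1 0 *: curf j u).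
Proof.
have -> : x 1 0 *: curf j u = cura z (fun l => x 1 0 *: irr_f F (a l) + 0) j u.
  rewrite cura_comb [X in _ = _ + X]big1 ?addr0 // => l _.
  have -> : on_factor (0 : 'M_(a l)) u = 0 :> T; last exact: scaler0.
  by apply/ffunP => m; rewrite !ffunE big1 // => k _; rewrite mxE mul0r.
by rewrite -!cura_comb; apply: eq_cura => l; rewrite addr0 addrA.
Qed.

Lemma cur_e j u : cur z (delta_mx 0 1) j u = cure j u.
Proof. by rewrite cur_efh !mxE /= !scale0r scale1r !addr0. Qed.

Lemma curhe i j u : curh i (cure j u) = cure j (curh i u) + 2 *: cure (i + j) u.
Proof.
rewrite /curh /cure cura_comm; congr (_ + _).
have -> : cura z (fun l => irr_h F (a l) *m irr_e F (a l) -
    irr_e F (a l) *m irr_h F (a l)) (i + j) u =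
    cura z (fun l => 1 *: irr_e F (a l) + irr_e F (a l)) (i + j) u.
  by apply: eq_cura => l; rewrite irr_he scale1r scaler_nat mulr2n.
by rewrite cura_comb scale1r scaler_nat mulr2n.
Qed.

Lemma curfe i j u : curf i (cure j u) = cure j (curf i u) - curh (i + j) u.
Proof.
rewrite /curf /cure cura_comm; congr (_ + _).
(* [cura_comb] handles combinations c X + Y, so -h is written as -2 h + h. *)
have -> : cura z (fun l => irr_f F (a l) *m irr_e F (a l) -
    irr_e F (a l) *m irr_f F (a l)) (i + j) u =
    cura z (fun l => -2 *: irr_h F (a l) + irr_h F (a l)) (i + j) u.
  by apply: eq_cura => l; rewrite irr_fe scaleNr scaler_nat mulr2n opprD addrNK.
by rewrite cura_comb scaleNr scaler_nat mulr2n opprD addrNK.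
Qed.

Lemma lowestE m : lowest F a m = [forall l, m l == 0%N :> nat]%:R.
Proof. by rewrite ffunE. Qed.

Lemma curf_lowest j : curf j (lowest F a) = 0.
Proof.
rewrite /curf /cura big1 // => l _; apply/eqP; rewrite scaler_eq0; apply/orP; right.
apply/eqP/ffunP => m; rewrite on_factorE ffunE big1 // => k _.
rewrite mxE lowestE; case: eqP => [_|]; last by rewrite mulr0n mul0r.
case: forallP => [/(_ l)|_]; last by rewrite mulr0.
by rewrite mset_in => /eqP ->; rewrite mul0n mul0r.
Qed.

Lemma curh_lowest j : exists c, curh j (lowest F a) = c *: lowest F a.
Proof.
exists (\sum_l z l ^+ j * - (a l).-1%:R); rewrite scaler_suml; apply: eq_bigr => l _.
rewrite -scalerA; congr (_ *: _); apply/ffunP => m.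
rewrite on_factorE ffunE -[_ *: (_ : F^o)]/(_ * _).
rewrite (bigD1 (m l)) // big1 /= => [|k km]; last first.
  by rewrite mxE eq_sym (negbTE km) mulr0n mul0r.
rewrite (mset_eq (m' := m)) // addr0 mxE eqxx mulr1n lowestE.
case: forallP => [/(_ l)/eqP ->|_]; last by rewrite !mulr0.
by rewrite double0 sub0r.
Qed.

Definition emon js : T := foldr cure (lowest F a) js.

Lemma emon_monomial js :
  emon js = monomial a z [seq (delta_mx 0 1, j) | j <- js].
Proof. by elim: js => //= j js ->; rewrite cur_e. Qed.

Lemma iter_cure i t : iter t (cure i) (lowest F a) = emon (nseq t i).
Proof. by elim: t => //= t ->. Qed.

(** Candidate for F_s built from the e_j alone. The inductive form lets a property stable under
    combinations be checked on monomials. *)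
Inductive espan (s : nat) : T -> Prop :=
| espan_mon js : (sumn js <= s)%N -> espan s (emon js)
| espan_comb c u v : espan s u -> espan s v -> espan s (c *: u + v).

Lemma espan0 s : espan s 0.
Proof.
have := @espan_comb s (-1) _ _ (@espan_mon s [::] isT) (@espan_mon s [::] isT).
by rewrite scaleN1r addNr.
Qed.

Lemma espanZ s c u : espan s u -> espan s (c *: u).
Proof. by move=> su; rewrite -[_ *: _]addr0; apply: espan_comb su (espan0 s). Qed.

Lemma espanD s u v : espan s u -> espan s v -> espan s (u + v).
Proof. by move=> su; rewrite -[u]scale1r; apply: espan_comb. Qed.

Lemma espan_linear (phi : {linear T -> T}) s s' :
  (forall js, (sumn js <= s)%N -> espan s' (phi (emon js))) ->
  forall u, espan s u -> espan s' (phi u).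
Proof.
move=> H u; elim=> [js /H//|c {}u v _ su _ sv].
by rewrite linearP; apply: espan_comb.
Qed.

Lemma espan_mono s s' u : (s <= s')%N -> espan s u -> espan s' u.
Proof.
move=> ss; elim=> [js le|c {}u v _ su _ sv]; last exact: espan_comb.
by apply: espan_mon; apply: leq_trans ss.
Qed.

Lemma espan_cure s j u : espan s u -> espan (s + j) (cure j u).
Proof.
apply: espan_linear => js le; apply: (@espan_mon _ (j :: js)) => /=.
by rewrite addnC leq_add2r.
Qed.

Lemma espan_curh s j u : espan s u -> espan (s + j) (curh j u).
Proof.
move: u; apply: espan_linear => js le.
suff H : espan (sumn js + j) (curh j (emon js)).
  by apply: espan_mono H; rewrite leq_add2r.
elim: js j {le} => [|i js IH] j /=.
  by have [c ->] := curh_lowest j; apply/espanZ/(@espan_mon _ [::]).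
rewrite curhe; apply: espanD.
  by rewrite -addnA addnC; apply/espan_cure/IH.
apply: espanZ; apply: (@espan_mon _ (j + i :: js)%N) => /=.
by lia.
Qed.

Lemma espan_curf s j u : espan s u -> espan (s + j) (curf j u).
Proof.
move: u; apply: espan_linear => js le.
suff H : espan (sumn js + j) (curf j (emon js)).
  by apply: espan_mono H; rewrite leq_add2r.
elim: js j {le} => [|i js IH] j /=; first by rewrite curf_lowest; apply: espan0.
rewrite curfe; apply: espanD.
  by rewrite -addnA addnC; apply/espan_cure/IH.
rewrite -scaleN1r; apply: espanZ; have := @espan_curh (sumn js) (j + i) _ (@espan_mon _ js (leqnn _)).
by congr espan; lia.
Qed.

Lemma espan_cur s x j u : espan s u -> espan (s + j) (cur z x j u).
Proof.
move=> su; rewrite cur_efh; apply/espan_comb; first exact: espan_cure.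
by apply: espan_comb; [exact: espan_curh|exact/espanZ/espan_curf].
Qed.

(** Each h_j or f_j is moved to the right through the e's. The commutators preserve the total
    t-degree, and at the end h_j acts on the lowest vector by a scalar and f_j by 0. *)
Lemma Fil_espan s u : Fil z s u -> espan s u.
Proof.
move=> [ws [uw H]]; rewrite (coord_span (X := in_tuple ws) uw); apply: (big_ind (espan s)); [exact: espan0|exact: espanD|move=> k _].
apply: espanZ; have [xs [-> _ le]] := H _ (mem_nth 0 (ltn_ord k)).
apply: espan_mono le _; elim: xs => [|[x j] xs IH] /=.
  exact: (@espan_mon 0 [::] isT).
by rewrite addnC; apply: espan_cur.
Qed.

Lemma Fil_emon js : Fil z (sumn js) (emon js).
Proof.
exists [:: emon js]; split=> [|w]; first by rewrite memv_span ?inE.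
rewrite inE => /eqP ->; exists [seq (delta_mx 0 1, j) | j <- js]; split.
- exact: emon_monomial.
- move=> _ /mapP[j _ ->]; rewrite /= /mxtrace !big_ord_recl big_ord0 !mxE /=.
  by rewrite !addr0.
- by rewrite -map_comp map_id.
Qed.

Lemma Fil_cure s j u : Fil z s u -> Fil z (s + j) (cure j u).
Proof.
rewrite -cur_e; apply: Fil_cur.
by rewrite /mxtrace !big_ord_recl big_ord0 !mxE /= !addr0.
Qed.

Lemma Fil_pred_comb s c u v :
  Fil_pred z s u -> Fil_pred z s v -> Fil_pred z s (c *: u + v).
Proof. by case: s => [-> ->|s]; [rewrite scaler0 addr0|exact: FilL]. Qed.

Lemma Fil_pred0 s : Fil_pred z s (0 : T).
Proof. by case: s => // s; exact: Fil0. Qed.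

Lemma Fil_pred_cure s j u : Fil_pred z s u -> Fil_pred z (s + j) (cure j u).
Proof.
case: s => [->|s]; first by rewrite linear0; apply: Fil_pred0.
exact: Fil_cure.
Qed.

Lemma Fil_pred_cure_lt s i j u : (j < i)%N ->
  Fil z s u -> Fil_pred z (s + i) (cure j u).
Proof.
case: i => // i ji su; rewrite addnS /=; apply: Fil_mono (Fil_cure j su).
by rewrite leq_add2l.
Qed.

Lemma card_ord_geq (k : nat) : (k <= n)%N -> \sum_(l < n | (n - k <= l)%N) 1 = k.
Proof.
move=> kn; rewrite -(big_geq_mkord (n - k) n xpredT (fun=> 1%N)).
by rewrite sum_nat_const_nat subKn // muln1.
Qed.

(* For p the polynomial vanishing at the z_l with n - i <= l, the operator    *)
(* y = sum_j p_j e_j only involves the factors with l < n - i, so that        *)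
(* y^(D+1) = 0, whereas y = e_i modulo e_0, ..., e_(i-1).                     *)
Lemma iter_cure_upper (i : 'I_n) (D := (\sum_(l < n | (l < n - i)%N) (a l).-1)%N) :
  Fil_pred z (i * D.+1) (iter D.+1 (cure i) (lowest F a)).
Proof.
pose p := \prod_(l < n | (n - i <= l)%N) ('X - (z l)%:P).
have szp : size p = i.+1.
  rewrite /p -big_filter size_prod_XsubC; congr _.+1.
  by rewrite size_filter -sum1_count card_ord_geq // ltnW.
have lcp : p`_i = 1.
  have /monicP : p \is monic by apply: monic_prod => l _; exact: monicXsubC.
  by rewrite lead_coefE szp.
pose y (u : T) : T := \sum_(j < i.+1) p`_j *: cure j u.
have yE u m : y u m = \sum_l p.[z l] * on_factor (irr_e F (a l)) u m.
  rewrite sum_ffunE; under eq_bigr => j _.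
    rewrite ffunE sum_ffunE -[_ *: (_ : F^o)]/(_ * _) mulr_sumr.
    over.
  rewrite exchange_big; apply: eq_bigr => l _ /=; rewrite horner_coef szp mulr_suml.
  by apply: eq_bigr => j _; rewrite ffunE -[_ *: (_ : F^o)]/(_ * _) mulrA.
have yi u : y u = cure i u + \sum_(j < i) p`_j *: cure j u.
  by rewrite /y big_ord_recr /= lcp scale1r addrC.
(* As p vanishes at z_l for l >= n - i, each application of y raises by one the total degree in the
   remaining factors, which is at most D. *)
have supp t m : iter t y (lowest F a) m != 0 ->
    (\sum_(l < n | (l < n - i)%N) m l = t)%N.
  elim: t m => [|t IH] m.
    rewrite /= lowestE; case: forallP => [H _|]; last by rewrite eqxx.
    by rewrite big1 // => l _; exact/eqP/H.
  rewrite iterS yE => /eqP; have [/existsP[l /andP[pl]]|] :=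
    boolP [exists l, (p.[z l] != 0) &&
      (on_factor (irr_e F (a l)) (iter t y (lowest F a)) m != 0)]; last first.
    rewrite negb_exists => /forallP H []; apply: big1 => l _; apply/eqP.
    by have := H l; rewrite mulf_eq0 negb_and !negbK.
  rewrite on_factorE => /eqP Hl _.
  have li : (l < n - i)%N.
    rewrite ltnNge; apply: contra pl => li.
    by rewrite /p (bigD1 l) //= hornerM hornerXsubC subrr mul0r.
  have [/existsP[k]|] := boolP [exists k, irr_e F (a l) (m l) k *
      iter t y (lowest F a) (mset m k) != 0]; last first.
    rewrite negb_exists => /forallP H; case: Hl; apply: big1 => k _; apply/eqP.
    by have := H k; rewrite negbK.
  rewrite mulf_eq0 negb_or mxE => /andP[]; case: (m l =P k.+1 :> nat) => [mlk _ /IH|]; last by rewrite eqxx.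
  rewrite (bigD1 l) //= [X in _ -> X = _](bigD1 l) //= mset_in mlk => <-.
  rewrite addSn; congr (_ + _).+1.
  by apply: eq_bigr => l' /andP[_ ll']; rewrite mset_out // eq_sym.
have y0 : iter D.+1 y (lowest F a) = 0.
  apply/ffunP => m; rewrite ffunE; apply/eqP/contraT => /supp E.
  have : (\sum_(l < n | (l < n - i)%N) m l <= D)%N.
    by apply: leq_sum => l _; rewrite -ltnS (ltn_predK (ltn_ord (m l))).
  by rewrite E ltnn.
(* Induction on the congruence e_i^t v = y^t v modulo F_(i t - 1); the first component is what lets
   the terms e_j, j < i, of y be discarded. *)
suff H t : Fil z (i * t) (iter t y (lowest F a)) /\
    Fil_pred z (i * t) (iter t (cure i) (lowest F a) - iter t y (lowest F a)).
  by have [_] := H D.+1; rewrite y0 subr0.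
elim: t => [|t [IH1 IH2]].
  by rewrite muln0 subrr; split=> //; exact: (Fil_emon [::]).
have low : Fil_pred z (i * t + i) (\sum_(j < i) p`_j *: cure j (iter t y (lowest F a))).
  apply: (big_ind (Fil_pred z (i * t + i))) => [|u v|j _]; first exact: Fil_pred0.
    by move=> Fu Fv; have := Fil_pred_comb 1 Fu Fv; rewrite scale1r.
  rewrite -[_ *: _]addr0; apply/Fil_pred_comb/Fil_pred0.
  exact: Fil_pred_cure_lt.
rewrite mulnS addnC !iterS; split.
  apply: (big_ind (Fil z (i * t + i))) => [|u v|j _]; first exact: Fil0.
    by move=> Fu Fv; have := FilL 1 Fu Fv; rewrite scale1r.
  rewrite -[_ *: _]addr0; apply/FilL/Fil0; apply: Fil_mono (Fil_cure j IH1).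
  by rewrite leq_add2l -ltnS.
rewrite yi opprD addrA -linearB /= addrC -[- \sum_(j < i) _]scaleN1r.
by apply: Fil_pred_comb => //; exact: Fil_pred_cure.
Qed.

End LowestWeight.

(** * Derivations dual to the e_j, and determinants as test polynomials *)

Section CurrentDerivation.
Variables (F : numFieldType) (n : nat) (z : 'I_n -> F).
Implicit Types (P Q : {mpoly F[n]}) (js : seq nat).

Lemma mpoly_mulind (K : {mpoly F[n]} -> Prop) :
  (forall c, K c%:MP) -> (forall l, K 'X_l) ->
  (forall P Q, K P -> K Q -> K (P + Q)) -> (forall P Q, K P -> K Q -> K (P * Q)) ->
  forall P, K P.
Proof.
move=> KC KX KD KM; elim/mpolyind => [|c m P _ _ KP]; first by rewrite -(mpolyC0 n); apply: KC.
apply: (KD) => //; rewrite -mul_mpolyC; apply: (KM) => //; rewrite mpolyXE_id.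
apply: (big_ind K) => // [|l _]; first exact: (KC 1).
elim: (m l) => [|k IH]; first by rewrite expr0; exact: (KC 1).
by rewrite exprS; exact: KM.
Qed.

(* the derivation of F[X_1, ..., X_n] adjoint to the multiplication by        *)
(* e_j = sum_l z_l^j X_l *)
Definition cder j P : {mpoly F[n]} := \sum_l z l ^+ j *: P^`M(l).

Lemma cder_linear j : linear (cder j).
Proof.
move=> c P Q; rewrite scaler_sumr -big_split; apply: eq_bigr => l _ /=.
by rewrite linearP scalerDr !scalerA mulrC.
Qed.

HB.instance Definition _ j :=
  GRing.isLinear.Build F {mpoly F[n]} {mpoly F[n]} _ (cder j) (cder_linear j).

Lemma cderM j P Q : cder j (P * Q) = cder j P * Q + P * cder j Q.
Proof.
rewrite mulr_suml mulr_sumr -big_split; apply: eq_bigr => l _ /=.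
by rewrite mderivM scalerDr scalerAl scalerAr.
Qed.

Lemma cderC j c : cder j c%:MP = 0.
Proof. by apply: big1 => l _; rewrite mderivC scaler0. Qed.

Lemma cderX j l : cder j 'X_l = (z l ^+ j)%:MP.
Proof.
rewrite /cder (bigD1 l) //= big1 => [|k kl]; last first.
  by rewrite mderivX mnm1E eq_sym (negbTE kl) scale0r scaler0.
rewrite mderivX mnm1E eqxx scale1r addr0.
have -> : (U_(l) - U_(l) = 0)%MM by apply/mnmP => k; rewrite mnmBE subnn mnm0E.
by rewrite mpolyX0 alg_mpolyC.
Qed.

(** Transposition reverses the order: the head of js acts last in [emon] and first here, so that
    both unfold along the same recursion. *)
Definition cders js P := foldl (fun Q j => cder j Q) P js.

Lemma cders_linear js : linear (cders js).
Proof. by elim: js => // j js IH c P Q; rewrite /cders /= linearP; exact: IH. Qed.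

HB.instance Definition _ js :=
  GRing.isLinear.Build F {mpoly F[n]} {mpoly F[n]} _ (cders js) (cders_linear js).

(** The Leibniz rule distributes js over the two factors, and the constant term is multiplicative;
    some distribution must contribute. *)
Lemma cdersM js P Q : (cders js (P * Q))@_0 != 0 -> exists I J,
  [/\ (size I + size J = size js)%N, (sumn I + sumn J = sumn js)%N,
      (cders I P)@_0 != 0 & (cders J Q)@_0 != 0].
Proof.
elim: js P Q => [|j js IH] P Q /=.
  rewrite rmorphM mulf_eq0 negb_or => /andP[P0 Q0].
  by exists [::], [::].
rewrite cderM linearD mcoeffD => H.
have /orP[/IH|/IH] : ((cders js (cder j P * Q))@_0 != 0) ||
    ((cders js (P * cder j Q))@_0 != 0).
- rewrite -negb_and; apply: contra H => /andP[/eqP -> /eqP ->].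
  by rewrite addr0.
- by move=> [I [J [sz sm hI hJ]]]; exists (j :: I), J; split=> //=; lia.
- by move=> [I [J [sz sm hI hJ]]]; exists I, (j :: J); split=> //=; lia.
Qed.

(** As a functional on monomials in the e_j, P sees only those with k factors and total t-degree at
    least i k. It therefore kills F_(i k - 1), and [goodM] makes the property multiplicative. *)
Definition good i k P :=
  forall js, (cders js P)@_0 != 0 -> size js = k /\ (i * k <= sumn js)%N.

Lemma good1 i : good i 0 1.
Proof.
case=> [|j js]; first by rewrite muln0.
by rewrite /= cderC linear0 mcoeff0 eqxx.
Qed.

Lemma goodM i k k' P Q : good i k P -> good i k' Q -> good i (k + k') (P * Q).
Proof.
move=> gP gQ js /cdersM[I [J [<- <- /gP[-> hI] /gQ[-> hJ]]]].
by rewrite mulnDr leq_add.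
Qed.

Lemma cder_prod j (I : eqType) (r : seq I) (f : I -> {mpoly F[n]}) : uniq r ->
  cder j (\prod_(k <- r) f k) =
  \sum_(i <- r) \prod_(k <- r) (if k == i then cder j (f k) else f k).
Proof.
elim: r => [_|x r IH /= /andP[xr ur]]; first by rewrite !big_nil (cderC j 1).
rewrite !big_cons cderM {}IH // eqxx; congr (_ * _ + _).
  apply: eq_big_seq => k kr; case: eqP => // E.
  by rewrite -E kr in xr.
rewrite mulr_sumr; apply: eq_big_seq => i ir; rewrite big_cons.
by case: eqP => // E; rewrite E ir in xr.
Qed.

Lemma cder_det j (N : nat) (A : 'M[{mpoly F[n]}]_N) :
  cder j (\det A) =
  \sum_p \det (\matrix_(q, m) (if q == p then cder j (A q m) else A q m)).
Proof.
rewrite /determinant linear_sum [RHS]exchange_big; apply: eq_bigr => s _ /=.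
rewrite cderM (_ : cder j _ = 0) ?mul0r ?add0r; last first.
  by rewrite -mpolyC1 -mpolyCN -rmorphXn cderC.
rewrite cder_prod ?index_enum_uniq // -mulr_sumr; congr (_ * _).
by apply: eq_bigr => p _; apply: eq_bigr => q _; rewrite mxE.
Qed.

Lemma leq_sum_ord_uniq (s : seq nat) : uniq s -> (\sum_(k < size s) k <= sumn s)%N.
Proof.
move Es : (size s) => N; elim: N s Es => [|N IH] s Es us; first by rewrite big_ord0.
(* Pigeonhole: N + 1 distinct numbers cannot all be below N. An element that is at least N is
   removed. *)
have /hasP[x xs Nx] : has (fun x => N <= x)%N s.
  rewrite -[has _ _]negbK -all_predC; apply/negP => /allP H.
  have : {subset s <= iota 0 N}.
    by move=> x /H /=; rewrite mem_iota add0n ltnNge.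
  by move=> /(uniq_leq_size us); rewrite size_iota Es ltnn.
rewrite big_ord_recr /= (perm_sumn (perm_to_rem xs)) /= addnC leq_add //.
by apply: IH; rewrite ?rem_uniq // size_rem // Es.
Qed.

Section Determinant.
Variables (N : nat) (g : 'I_N -> 'I_n).

(** U is the set of rows still carrying variables. This family is closed under derivation:
    [cder_detP] strips one row of U of its variables and raises its exponent by j. *)
Definition detP (U : {set 'I_N}) (d : 'I_N -> nat) : {mpoly F[n]} :=
  \det (\matrix_(p, m) (z (g m) ^+ d p *: (if p \in U then 'X_(g m) else 1))).

Lemma cder_detP j U d : cder j (detP U d) =
  \sum_(p in U) detP (U :\ p) (fun q => d q + (if q == p then j else 0))%N.
Proof.
rewrite cder_det [RHS]big_mkcond; apply: eq_bigr => p _ /=; case: ifPn => pU.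
  congr (\det _); apply/matrixP => q m; rewrite !mxE !inE.
  have [->|_] := eqVneq q p; last by rewrite addn0.
  by rewrite pU linearZ /= cderX -alg_mpolyC scalerA exprD.
rewrite /determinant big1 // => s _; rewrite (bigD1 p) //= !mxE eqxx (negbTE pU).
by rewrite linearZ /= (cderC j 1) scaler0 mul0r mulr0.
Qed.

(** Once all derivations are applied, a row still carrying variables is zero at the origin, and two
    equal exponents give two equal rows. A nonzero value thus forces N distinct exponents, whose sum
    is at least 0 + ... + (N - 1). *)
Lemma detP_good js U d : (cders js (detP U d))@_0 != 0 ->
  #|U| = size js /\ (\sum_(p < N) p <= \sum_(p < N) d p + sumn js)%N.
Proof.
elim: js U d => [|j js IH] U d /=.
  rewrite /detP -det_map_mx => D0.
  have entry p m : (map_mx (mcoeff 0) (\matrix_(p, m) (z (g m) ^+ d p *: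
      (if p \in U then 'X_(g m) else 1 : {mpoly F[n]})))) p m =
      z (g m) ^+ d p * (p \notin U)%:R.
    rewrite !mxE mcoeffZ; case: ifP => _ /=; last by rewrite mcoeff1 eqxx.
    by rewrite mcoeffX; case: eqP => // /mnmP/(_ (g m)); rewrite mnm1E eqxx mnm0E.
  have U0 : U = set0.
    apply/setP => p; rewrite inE; apply/negbTE; apply: contraNN D0 => pU.
    rewrite /determinant big1 // => s _.
    by rewrite (bigD1 p) //= entry pU mulr0 mul0r mulr0.
  split; first by rewrite U0 cards0.
  have d_inj : injective d.
    move=> p q E; apply/eqP; apply: contraNT D0 => pq; apply/eqP.
    by apply: (determinant_alternate pq) => m; rewrite !entry E U0 !inE.
  rewrite addn0; have := @leq_sum_ord_uniq (map d (enum 'I_N)).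
  rewrite map_inj_uniq ?enum_uniq // => /(_ isT).
  by rewrite size_map size_enum_ord sumnE big_map big_enum.
rewrite cder_detP !linear_sum => H.
have [/existsP[p /andP[pU /IH[sz le]]]|] := boolP [exists p, (p \in U) &&
    ((cders js (detP (U :\ p) (fun q => d q + (if q == p then j else 0))%N))@_0 != 0)].
  split; first by rewrite (cardsD1 p U) pU sz.
  rewrite (leq_trans le) // big_split /= -big_mkcond big_pred1_eq; lia.
rewrite negb_exists => /forallP H0; case/eqP: H; apply: big1 => p pU /=.
by apply/eqP; have := H0 p; rewrite pU negbK.
Qed.

End Determinant.
End CurrentDerivation.

(** * Evaluation of the test polynomials on powers of e_i *)

Section Specialization.
Variables (F : numFieldType) (n : nat) (z : 'I_n -> F) (i : nat).
Implicit Types (P Q : {mpoly F[n]}).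

(** Restriction of P to the line spanned by (z_l^i)_l, the direction of the derivation [cder z i].
    That derivation becomes d/dX, so pairing P with e_i^t extracts t! times a coefficient
    ([cders_nseq]). *)
Definition spec P : {poly F} := mmap polyC (fun l => (z l ^+ i)%:P * 'X) P.

HB.instance Definition _ := GRing.RMorphism.copy spec
  (mmap (polyC : F -> {poly F}) (fun l => (z l ^+ i)%:P * 'X)).

Lemma specZ c P : spec (c *: P) = c%:P * spec P.
Proof. exact: mmapZ. Qed.

Lemma specX l : spec 'X_l = (z l ^+ i)%:P * 'X.
Proof. by rewrite /spec mmapX mmap1U. Qed.

Lemma spec_cder P : spec (cder z i P) = (spec P)^`().
Proof.
elim/mpoly_mulind: P => [c|l|P Q hP hQ|P Q hP hQ].
- by rewrite cderC rmorph0 /spec mmapC derivC.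
- by rewrite cderX specX derivM derivC derivX mul0r add0r mulr1 /spec mmapC.
- by rewrite (linearD (cder z i)) !rmorphD /= derivD hP hQ.
- by rewrite cderM rmorphD !rmorphM /= hP hQ derivM.
Qed.

Lemma coef0_spec P : (spec P)`_0 = P@_0.
Proof.
rewrite -horner_coef0; elim/mpoly_mulind: P => [c|l|P Q hP hQ|P Q hP hQ].
- by rewrite /spec mmapC hornerC mcoeffC eqxx mulr1.
- rewrite specX hornerM hornerX mulr0 mcoeffX.
  by case: eqP => // /mnmP/(_ l); rewrite mnm1E eqxx mnm0E.
- by rewrite rmorphD /= hornerD hP hQ mcoeffD.
- by rewrite !rmorphM /= hornerM hP hQ.
Qed.

Lemma cders_nseq t P : (cders z (nseq t i) P)@_0 = (spec P)`_t *+ t`!.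
Proof.
suff -> : (cders z (nseq t i) P)@_0 = ((spec P)^`(t))`_0.
  by rewrite coef_derivn addn0 ffactnn.
elim: t P => [|t IH] P; first by rewrite coef0_spec.
by rewrite derivSn -spec_cder -IH.
Qed.

Section Determinant.
Variables (N : nat) (g : 'I_N -> 'I_n).

Definition upper : {set 'I_N} := [set p : 'I_N | (i <= p)%N].

Definition detU : {mpoly F[n]} :=
  detP z g upper (fun p => if (i <= p)%N then p - i else p)%N.

Lemma card_upper : #|upper| = (N - i)%N.
Proof.
have [iN|Ni] := leqP i N; last first.
  rewrite (eqP (ltnW Ni : (N - i == 0)%N)); apply: eq_card0 => p; rewrite !inE.
  by rewrite leqNgt (ltn_trans (ltn_ord p)).
rewrite -sum1_card (eq_bigl (fun p : 'I_N => (i <= p)%N)) => [|p]; last by rewrite inE.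
by rewrite -(big_geq_mkord i N xpredT (fun=> 1%N)) sum_nat_const_nat muln1.
Qed.

(** The exponents sum to 0 + ... + (N - 1) less i for each of the N - i upper rows, and [detP_good]
    makes js supply the deficit. *)
Lemma detU_good : good z i (N - i) detU.
Proof.
move=> js /detP_good[sz].
suff -> : (\sum_(p < N) p = \sum_(p < N) (if i <= p then p - i else p) + i * #|upper|)%N.
  by rewrite -card_upper sz leq_add2l.
rewrite mulnC -sum_nat_const [X in (_ + X)%N]big_mkcond -big_split /=.
by apply: eq_bigr => p _; rewrite inE; case: ifP => [/subnK|_] //; rewrite addn0.
Qed.

Hypotheses (g_inj : injective g) (z_inj : injective z).

(** On the line, an upper row becomes z^(p - i) z^i X = z^p X: the matrix is a diagonal one times a
    Vandermonde matrix of distinct points. *)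
Lemma spec_detU : exists2 c, c != 0 & spec detU = c%:P * 'X^(N - i).
Proof.
pose V : 'M[F]_N := \matrix_(p, m) z (g m) ^+ p.
exists (\det V).
  have -> : V = Vandermonde N (\row_m z (g m)) by apply/matrixP => p m; rewrite !mxE.
  rewrite det_Vandermonde; apply/prodf_neq0 => p _; apply/prodf_neq0 => q pq.
  rewrite !mxE subr_eq0 (inj_eq z_inj) (inj_eq g_inj) eq_sym.
  by apply: contraTneq pq => ->; rewrite ltnn.
rewrite /detU /detP -det_map_mx.
rewrite (_ : map_mx _ _ =
    diag_mx (\row_p (if p \in upper then 'X else 1)) *m map_mx polyC V); last first.
  apply/matrixP => p m; rewrite mul_diag_mx !mxE /= specZ inE; case: ifP => ip.
    by rewrite specX mulrA -polyCM -exprD subnK // mulrC.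
  by rewrite rmorph1 mulr1 mul1r.
rewrite det_mulmx det_diag det_map_mx mulrC; congr (_ * _).
under eq_bigr => p _ do rewrite mxE.
by rewrite -big_mkcond prodr_const card_upper.
Qed.

End Determinant.
End Specialization.

(** * Degrees in a single variable *)

Section Degree.
Variables (F : numFieldType) (n : nat) (l : 'I_n).
Implicit Types (P Q : {mpoly F[n]}).

Definition degle d P := forall m, P@_m != 0 -> (m l <= d)%N.

Lemma degleM d e P Q : degle d P -> degle e Q -> degle (d + e) (P * Q).
Proof.
move=> dP eQ m; rewrite -mcoeff_msupp => /msuppM_le/allpairsP[[m1 m2] /= [h1 h2 ->]].
by rewrite mnmDE leq_add ?dP ?eQ // -mcoeff_msupp.
Qed.

Lemma degle_mono d e P : (d <= e)%N -> degle d P -> degle e P.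
Proof. by move=> de dP m /dP h; exact: leq_trans de. Qed.

Lemma degleZ d c P : degle d P -> degle d (c *: P).
Proof. by move=> dP m; rewrite mcoeffZ mulf_eq0 negb_or => /andP[_ /dP]. Qed.

Lemma degle_sum d (I : Type) (r : seq I) (G : I -> {mpoly F[n]}) :
  (forall k, degle d (G k)) -> degle d (\sum_(k <- r) G k).
Proof.
move=> dG; apply: (big_ind (degle d)) => [m|P Q dP dQ m|k _]; last exact: dG.
  by rewrite mcoeff0 eqxx.
rewrite mcoeffD => PQ; have [/eqP P0|/dP //] := boolP (P@_m == 0).
by move: PQ; rewrite P0 add0r => /dQ.
Qed.

Lemma degle1 : degle 0 (1 : {mpoly F[n]}).
Proof.
by move=> m; rewrite mcoeff1; case: (m =P 0%MM) => [->|_]; rewrite ?mnm0E ?eqxx.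
Qed.

Lemma degle_prod (I : Type) (r : seq I) (d : I -> nat) (G : I -> {mpoly F[n]}) :
  (forall k, degle (d k) (G k)) -> degle (\sum_(k <- r) d k) (\prod_(k <- r) G k).
Proof.
move=> dG; elim: r => [|k r IH]; first by rewrite !big_nil; exact: degle1.
by rewrite !big_cons; apply: degleM.
Qed.

Lemma degleX (l' : 'I_n) : degle (l' == l) ('X_l' : {mpoly F[n]}).
Proof.
by move=> m; rewrite mcoeffX; case: (U_(l')%MM =P m) => [<-|_]; rewrite ?mnm1E ?eqxx.
Qed.

(** X_l occurs only in the columns m with g m = l, and each term of the determinant takes one entry
    per column. *)
Lemma degle_detP z (N : nat) (g : 'I_N -> 'I_n) U d :
  degle (\sum_m (g m == l))%N (detP z g U d).
Proof.
apply: degle_sum => s.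
have -> : (-1) ^+ s = ((-1) ^+ s : F)%:MP_[n] by rewrite rmorphXn rmorphN1.
rewrite mul_mpolyC; apply: degleZ; rewrite (reindex_inj (@perm_inj _ s)) /=.
apply: degle_prod => p; rewrite mxE; apply: degleZ; case: ifP => _.
  exact: degleX.
exact: degle_mono degle1.
Qed.

End Degree.

(** * The lower bound for the nilpotency order *)

Section LowerBound.
Variables (F : numFieldType) (n : nat) (a : 'I_n -> nat) (z : 'I_n -> F).
Local Notation T := (tensor F a).
Local Notation index := {dffun forall l : 'I_n, 'I_(a l)}.
Implicit Types (u : T) (m : index) (P : {mpoly F[n]}).

Definition mnm_of m : 'X_{1..n} := [multinom (m l : nat) | l < n].
Definition mfact m : F := \prod_l (m l)`!%:R.

(** The basis vector indexed by m is the monomial x^m, and d/dX_l is adjoint to x_l for the pairing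
    where X^m and x^m pair to m!, which is [mfact m]. *)
Lemma emon_cders js m : mfact m * emon a z js m = (cders z js 'X_[mnm_of m])@_0.
Proof.
elim: js m => [|j js IH] m /=.
  rewrite mcoeffX lowestE; case: forallP => [H|H].
    rewrite mulr1 /mfact big1 => [|l _]; last by rewrite (eqP (H l)).
    by case: eqP => // -[]; apply/mnmP => l; rewrite mnmE mnm0E (eqP (H l)).
  rewrite mulr0; case: eqP => // /mnmP E; case: H => l.
  by have := E l; rewrite mnmE mnm0E => ->.
rewrite /cure /cura sum_ffunE mulr_sumr /cder linear_sum raddf_sum /=.
apply: eq_bigr => l _; rewrite mderivX scalerA linearZ mcoeffZ /=.
rewrite ffunE -[_ *: (_ : F^o)]/(_ * _) mulrCA -!mulrA; congr (_ * _).
rewrite on_factorE mnmE mulr_sumr.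
have term (k : 'I_(a l)) : mfact m * (irr_e F (a l) (m l) k * emon a z js (mset m k)) =
    (m l == k.+1 :> nat)%:R * ((m l)%:R * (cders z js 'X_[mnm_of (mset m k)])@_0).
  rewrite mxE; case: eqP => [mlk|_]; last by rewrite !mul0r mulr0.
  rewrite !mul1r -IH mulrA; congr (_ * _); rewrite /mfact (bigD1 l) //=.
  rewrite [X in _ = _ * X](bigD1 l) //= mset_in mlk factS natrM -!mulrA.
  by congr (_ * (_ * _)); apply: eq_bigr => l' ll'; rewrite mset_out // eq_sym.
rewrite (eq_bigr _ (fun k _ => term k)).
case: (posnP (m l)) => [ml0|mlp].
  by rewrite ml0 mul0r big1 // => k _; rewrite mul0r.
have kb : ((m l).-1 < a l)%N by rewrite (leq_ltn_trans (leq_pred _)).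
rewrite (bigD1 (Ordinal kb)) //= big1 => [|k /eqP kk]; last first.
  case: eqP => [E|_]; last by rewrite mul0r.
  by case: kk; apply: val_inj; rewrite /= E.
rewrite prednK // eqxx mul1r addr0; congr (_ * (cders z js 'X_[_])@_0).
apply/mnmP => l'; rewrite mnmBE !mnmE; have [<-|ll'] := eqVneq l l'.
  by rewrite mset_in subn1.
by rewrite mset_out // subn0.
Qed.

Definition pairing P u : F := \sum_m P@_(mnm_of m) * mfact m * u m.

Lemma pairingP P c u v : pairing P (c *: u + v) = c * pairing P u + pairing P v.
Proof.
rewrite /pairing mulr_sumr -big_split; apply: eq_bigr => m _ /=.
by rewrite !ffunE -[_ *: (_ : F^o)]/(_ * _) mulrDr mulrCA.
Qed.

Lemma mnm_of_inj : injective mnm_of.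
Proof.
move=> m m' /mnmP E; apply/ffunP => l; apply: val_inj.
by have := E l; rewrite !mnmE.
Qed.

(** Monomials outside the box m_l < a_l are zero in the tensor product, so P must not involve
    them. *)
Lemma pairing_emon P js : (forall m : 'X_{1..n}, P@_m != 0 -> forall l, (m l < a l)%N) ->
  pairing P (emon a z js) = (cders z js P)@_0.
Proof.
move=> boxed; have {2}-> : P = \sum_(m : index) P@_(mnm_of m) *: 'X_[mnm_of m].
  apply/mpolyP => m; rewrite raddf_sum /=.
  under eq_bigr => m' _ do rewrite mcoeffZ mcoeffX.
  have [/eqP P0|/boxed H] := boolP (P@_m == 0).
    rewrite P0 big1 // => m' _.
    by case: eqP => [->|_]; rewrite ?P0 ?mul0r ?mulr0.
  pose m0 : index := [ffun l => Ordinal (H l)].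
  have mE : mnm_of m0 = m by apply/mnmP => l; rewrite mnmE ffunE.
  rewrite (bigD1 m0) //= mE eqxx mulr1 big1 ?addr0 // => m' m'm.
  rewrite -[in X in (_ == X)]mE (inj_eq mnm_of_inj).
  by rewrite (negbTE m'm) mulr0.
rewrite linear_sum raddf_sum; apply: eq_bigr => m _ /=.
by rewrite linearZ mcoeffZ -emon_cders mulrA.
Qed.

Lemma not_Fil_pred_iter i t P : (forall m : 'X_{1..n}, P@_m != 0 -> forall l, (m l < a l)%N) ->
  good z i t P -> (spec z i P)`_t != 0 ->
  ~ Fil_pred z (i * t) (iter t (@cure F n a z i) (lowest F a)).
Proof.
move=> boxed gP Pt; rewrite iter_cure.
have : pairing P (emon a z (nseq t i)) != 0.
  by rewrite pairing_emon // cders_nseq -mulr_natr mulf_neq0 // pnatr_eq0 -lt0n fact_gt0.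
have pairing0 : pairing P 0 = 0.
  by rewrite /pairing big1 // => m _; rewrite ffunE mulr0.
(* For i t = 0 the previous filtration step is 0; otherwise [good] kills every monomial of total
   degree less than i t. *)
case E: (i * t)%N => [|s] /eqP nz /= H; apply: nz; first by rewrite H.
have {H}/Fil_espan := H; elim=> [js le|c u v _ IHu _ IHv]; last first.
  by rewrite pairingP IHu IHv mulr0 addr0.
apply/eqP; rewrite pairing_emon //; apply: contraTT le => /gP[_].
by rewrite E ltnNge.
Qed.

Lemma sum_ltn_ord c t : (c <= t)%N -> (\sum_(k < t) (k < c) = c)%N.
Proof.
move=> ct; rewrite -[RHS]card_ord -sum1_card [RHS](big_ord_widen t (fun=> 1%N)) //.
by rewrite [RHS]big_mkcond.
Qed.

(** C^(a_l) behaves like a_l - 1 copies of C^2, and the t-th level S t gathers the factors having a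
    t-th copy. Each l lies in a_l - 1 levels, which bounds the degree in X_l; [\sum_l a l] exceeds
    every nonempty level. *)
Lemma lower_witness (i : nat) : injective z -> (forall l, (0 < a l)%N) ->
  exists2 K, (exists P, [/\ (forall m : 'X_{1..n}, P@_m != 0 -> forall l, (m l < a l)%N),
    good z i K P & (spec z i P)`_K != 0]) &
  K = (\sum_(t < \sum_l a l) (#|[set l | (t < (a l).-1)%N]| - i))%N.
Proof.
move=> z_inj ha; pose S (t : nat) := [set l | (t < (a l).-1)%N].
pose K (r : seq 'I_(\sum_l a l)) : nat := (\sum_(t <- r) (#|S t| - i))%N.
pose g t : 'I_#|S t| -> 'I_n := enum_val.
have gI t : injective (g t) by exact: enum_val_inj.
pose P (r : seq 'I_(\sum_l a l)) : {mpoly F[n]} := \prod_(t <- r) detU z i (g t).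
have gP r : good z i (K r) (P r).
  rewrite /K /P; elim: r => [|t r IH]; first by rewrite !big_nil; exact: good1.
  by rewrite !big_cons; apply: goodM => //; exact: detU_good.
have sP r : exists2 c, c != 0 & spec z i (P r) = c%:P * 'X^(K r).
  rewrite /K /P; elim: r => [|t r [c c0 IH]].
    by exists 1; rewrite ?oner_neq0 // !big_nil rmorph1 mulr1.
  have [d d0 dE] := spec_detU i (gI t) z_inj.
  exists (d * c); first by rewrite mulf_neq0.
  by rewrite !big_cons rmorphM /= dE IH polyCM exprD mulrACA.
pose R := index_enum 'I_(\sum_l a l).
exists (K R) => //.
exists (P R); split=> // [m Pm l|]; last first.
  have [c c0 ->] := sP R.
  by rewrite coefCM coefXn eqxx mulr1.
have /(_ m Pm) := @degle_prod F n l _ R _ (fun t : 'I_ _ => detU z i (g t))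
  (fun t : 'I_ _ => @degle_detP F n l z _ (g t) _ _).
move=> /leq_ltn_trans; apply.
rewrite (_ : \sum_(t <- R) _ = (a l).-1)%N ?prednK //.
have -> : (\sum_(t <- R) \sum_m (g t m == l) = \sum_(t <- R) (t < (a l).-1))%N.
  apply: eq_bigr => t _; case: (boolP (t < (a l).-1)%N) => tl.
    have lS : l \in S t by rewrite inE.
    rewrite (bigD1 (enum_rank_in lS l)) //= /g enum_rankK_in // eqxx big1 // => k.
    move=> kl; apply/eqP; rewrite eqb0; apply: contraNneq kl => kE; apply/eqP.
    by apply: (gI t); rewrite /g enum_rankK_in.
  apply: big1 => k _; apply/eqP; rewrite eqb0; apply: contraNneq tl => <-.
  by have := enum_valP k; rewrite inE.
rewrite sum_ltn_ord // (leq_trans (leq_pred _)) // (bigD1 l) //=.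
exact: leq_addr.
Qed.

Lemma iter_cure_lower (i : 'I_n) (D := (\sum_(l < n | (l < n - i)%N) (a l).-1)%N) :
  injective z -> (forall l, (0 < a l)%N) ->
  (forall j k : 'I_n, (j < k)%N -> (a j <= a k)%N) ->
  ~ Fil_pred z (i * D) (iter D (@cure F n a z i) (lowest F a)).
Proof.
move=> z_inj ha a_incr.
have [K [P [boxed gP sP]] KE] := lower_witness i z_inj ha.
have DK : (D <= K)%N.
  rewrite KE; set T0 := (\sum_l a l)%N.
  have DE : D = (\sum_(t < T0) \sum_(l < n | (l < n - i)%N) (t < (a l).-1))%N.
    rewrite exchange_big; apply: eq_bigr => l _ /=.
    rewrite sum_ltn_ord // (leq_trans (leq_pred _)) // /T0 (bigD1 l) //=.
    exact: leq_addr.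
  rewrite DE; apply: leq_sum => t _.
  (* If level t meets the first n - i factors, monotonicity puts all of the last i factors in it,
     and these are the i that are subtracted. Otherwise the left side is 0. *)
  have [/existsP[l0 /andP[l0i tl0]]|] :=
    boolP [exists l0 : 'I_n, (l0 < n - i)%N && (t < (a l0).-1)%N]; last first.
    rewrite negb_exists => /forallP H; rewrite big1 // => l li.
    by have := H l; rewrite li /= => /negbTE ->.
  rewrite -sum1dep_card [X in (_ <= X - _)%N]big_mkcond.
  rewrite [X in (_ <= X - _)%N](bigID (fun l : 'I_n => (l < n - i)%N)) /=.
  rewrite [X in (_ <= _ + X - _)%N](eq_big (fun l : 'I_n => (n - i <= l)%N) (fun=> 1%N)); first last.
  - move=> l; rewrite -leqNgt => li; rewrite (_ : (t < (a l).-1)%N) // (leq_trans tl0) // -!subn1 leq_sub2r //.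
    by apply: a_incr; exact: leq_trans l0i li.
  - by move=> l; rewrite -leqNgt.
  rewrite (card_ord_geq (ltnW (ltn_ord i))) addnK; apply: leq_sum => l _.
  by case: ifP.
(* The witness has degree K >= D; applying e_i another K - D times carries the assumed membership
   from D to K. *)
move=> H; apply: not_Fil_pred_iter boxed gP sP _.
rewrite -(subnK DK); elim: (K - D)%N => [//|k IH].
by rewrite addSn mulnS addnC iterS; exact: Fil_pred_cure.
Qed.

End LowerBound.

(** * Homogeneous functions, and morphisms given locally by homogeneous maps *)

Section HomogeneousMaps.
Variables (F : fieldType).
Implicit Types (V : vectType F).

(* The coordinates on V used by hev are those of vbasis {:V}; hfun and hmap   *)
(* express homogeneity independently of them. *)
Definition hfun V d (f : V -> F) : Prop :=
  exists2 p, p \is d.-homog & forall v, hev p v = f v.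

Definition hmap V V' d (G : V -> V') : Prop :=
  forall l : 'Hom(V', F^o), hfun d (fun v => l (G v)).

Lemma eq_hfun V d (f f' : V -> F) : (forall v, f v = f' v) -> hfun d f -> hfun d f'.
Proof. by move=> E [p hp H]; exists p => // v; rewrite H. Qed.

Lemma hfun_hev V d (p : {mpoly F[\dim {:V}]}) : p \is d.-homog -> hfun d (hev p).
Proof. by exists p. Qed.

Lemma hfun_form V (l : 'Hom(V, F^o)) : hfun 1 (fun v => l v : F).
Proof. by exists (mpoly_of_form l); [exact: mpoly_of_form_homog|exact: hev_form]. Qed.

Lemma hfun_scalar V (f : {linear V -> F^o}) : hfun 1 (f : V -> F).
Proof. by apply: eq_hfun (hfun_form (linfun f)) => v; rewrite lfunE. Qed.

Lemma hfunM V d e (f f' : V -> F) :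
  hfun d f -> hfun e f' -> hfun (d + e) (fun v => f v * f' v).
Proof.
move=> [p hp H] [q hq H']; exists (p * q); first exact: dhomogM.
by move=> v; rewrite hevM H H'.
Qed.

Lemma hfun1 V : hfun 0 (fun _ : V => 1).
Proof. by exists 1; [exact: dhomog1|move=> v; rewrite /hev meval1]. Qed.

Lemma hfunX V d k (f : V -> F) : hfun d f -> hfun (d * k) (fun v => f v ^+ k).
Proof.
move=> hf; elim: k => [|k IH]; first by rewrite muln0; exact: hfun1.
by rewrite mulnS; apply: eq_hfun (hfunM hf IH) => v; rewrite exprS.
Qed.

Lemma hfun_sum V d (I : Type) (r : seq I) (f : I -> V -> F) :
  (forall k, hfun d (f k)) -> hfun d (fun v => \sum_(k <- r) f k v).
Proof.
move=> hf; elim: r => [|k r [q hq H']].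
  by exists 0; [exact: dhomog0|move=> v; rewrite big_nil /hev meval0].
have [p hp H] := hf k; exists (p + q); first exact: dhomogD.
by move=> v; rewrite big_cons -H -H' /hev mevalD.
Qed.

Lemma hfunZ V d c (f : V -> F) : hfun d f -> hfun d (fun v => c * f v).
Proof.
move=> [p hp H]; exists (c *: p); first exact: rpredZ.
by move=> v; rewrite -H /hev mevalZ.
Qed.

Lemma hfunB V d (f f' : V -> F) :
  hfun d f -> hfun d f' -> hfun d (fun v => f v - f' v).
Proof.
move=> [p hp H] [q hq H']; exists (p - q); first exact: rpredB.
by move=> v; rewrite -H -H' /hev mevalB.
Qed.

Lemma hfun_scale V d (f : V -> F) c v : hfun d f -> f (c *: v) = c ^+ d * f v.
Proof. by move=> [p hp H]; rewrite -!H; exact: hevZ. Qed.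

Lemma hmap_sum V V' d (I : Type) (r : seq I) (f : I -> V -> F) (w : I -> V') :
  (forall k, hfun d (f k)) -> hmap d (fun v => \sum_(k <- r) f k v *: w k).
Proof.
move=> hf l; have := @hfun_sum V d I r (fun k v => (l (w k) : F) * f k v)
  (fun k => hfunZ _ (hf k)).
apply: eq_hfun => v; rewrite linear_sum; apply: eq_bigr => k _.
by rewrite linearZ mulrC.
Qed.

Lemma hfun_comp V V' d e (f : V' -> F) (G : V -> V') :
  hfun d f -> hmap e G -> hfun (d * e) (fun v => f (G v)).
Proof.
move=> [p hp H] hG.
have /choice[g gP] : forall i : 'I_(\dim {:V'}), exists g : {mpoly F[\dim {:V}]},
    g \is e.-homog /\ forall v, hev g v = coord (vbasis {:V'}) i (G v).
  move=> i; have [g hg gE] := hG (linfun (coord (vbasis {:V'}) i : V' -> F^o)).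
  by exists g; split=> // v; rewrite gE lfunE.
exists (p \mPo [tuple g i | i < \dim {:V'}]).
  rewrite comp_mpolyE big_seq; apply: rpred_sum => m /(dhomogP _ _ _ hp) /= <-.
  apply: rpredZ; rewrite mdegE big_distrl /=.
  apply: (big_rec2 (fun k (q : {mpoly F[\dim {:V}]}) => q \is k.-homog)) => [|i k q _ hq].
    exact: dhomog1.
  by apply: dhomogM hq; rewrite tnth_mktuple mulnC; by apply: dhomogMn; case: (gP i).
move=> v; rewrite -H /hev comp_mpoly_meval; apply: meval_eq => i.
by rewrite tnth_mktuple -(gP i).2.
Qed.

Lemma hmap_scale V V' d (G : V -> V') c v : hmap d G -> G (c *: v) = c ^+ d *: G v.
Proof.
move=> hG; apply/eqP; rewrite -subr_eq0; apply/eqP.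
rewrite [LHS](coord_vbasis (memvf _)) big1 // => i _.
have := hfun_scale c v (hG (linfun (coord (vbasis {:V'}) i : V' -> F^o))).
by rewrite !lfunE linearB linearZ /= => ->; rewrite subrr scale0r.
Qed.

Lemma vlineZ V c (v : V) : c != 0 -> <[c *: v]>%VS = <[v]>%VS.
Proof.
move=> c0; apply/eqP; rewrite eqEsubv -!memvE; apply/andP; split.
  by rewrite memvZ ?memv_line.
by rewrite -[X in X \in _](scalerK c0) memvZ ?memv_line.
Qed.

Lemma PP_lineE V (L : {vspace V}) v : PP L -> v \in L -> v != 0 -> L = <[v]>%VS.
Proof.
move=> PL vL v0; apply/eqP; rewrite eq_sym eqEdim -memvE vL PL dim_vline v0.
by [].
Qed.

Lemma PP_vpickE V (L : {vspace V}) : PP L -> L = <[vpick L]>%VS.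
Proof. by move=> PL; apply: PP_lineE; rewrite ?memv_pick ?PP_vpick. Qed.

Lemma vpick_vline V (v : V) : v != 0 -> exists2 c, c != 0 & vpick <[v]>%VS = c *: v.
Proof.
move=> v0; have /vlineP[c E] := memv_pick <[v]>%VS; exists c => //.
have := PP_vpick (PP_vline v0); rewrite E.
by apply: contraNneq => ->; rewrite scale0r.
Qed.

Lemma hev_vanish V d (p : {mpoly F[\dim {:V}]}) v :
  p \is d.-homog -> hev p v = 0 -> vanishes_on p <[v]>%VS.
Proof. by move=> hp v0 _ /vlineP[c ->]; rewrite (hevZ _ _ hp) v0 mulr0. Qed.

Lemma zclosure_hfun V (X : {vspace V} -> Prop) d (f : V -> F) L v :
  (forall L, X L -> PP L) -> hfun d f ->
  (forall L' u, X L' -> u \in L' -> u != 0 -> f u = 0) ->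
  zclosure X L -> v \in L -> f v = 0.
Proof.
move=> XP [p hp H] X0 [_ /(_ d p hp) XL] vL; rewrite -H; apply: XL vL => L' XL'.
rewrite (PP_vpickE (XP _ XL')); apply: (hev_vanish hp).
by rewrite H; apply: (X0 _ _ XL'); rewrite ?memv_pick ?PP_vpick //; exact: XP.
Qed.

Lemma zclosed_zclosure V (X : {vspace V} -> Prop) : zclosed (zclosure X).
Proof.
by move=> L [PL HL]; split=> // d p hp Hp; apply: (HL d) => // L' [_ /(_ d p hp)]; apply.
Qed.

Lemma zopen_neq0 V (X : {vspace V} -> Prop) d (f : V -> F) :
  (forall L, X L -> PP L) -> hfun d f ->
  zopen X (fun L => X L /\ f (vpick L) != 0).
Proof.
move=> XP [p hp H]; exists (fun L => PP L /\ vanishes_on p L).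
split=> [|L]; first exact: zclosed_vanish hp.
split=> -[XL fL]; split=> //.
  by move=> [_ /(_ _ (memv_pick L))]; rewrite H => f0; rewrite f0 eqxx in fL.
apply/eqP => f0; apply: fL; split; first exact: XP.
rewrite [L in vanishes_on _ L]PP_vpickE; last exact: XP.
by apply: (hev_vanish hp); rewrite H.
Qed.

Lemma zopen_trans V (X Y Z : {vspace V} -> Prop) : zopen X Y -> zopen Y Z -> zopen X Z.
Proof.
move=> [C [cC CE]] [C' [cC' CE']]; exists (fun L => C L \/ C' L).
split=> [|L]; first exact: zclosedU.
by rewrite CE' CE; tauto.
Qed.

Lemma zopen_sub V (X Y Z : {vspace V} -> Prop) :
  (forall L, Z L -> Y L) -> (forall L, Y L -> X L) -> zopen X Z -> zopen Y Z.
Proof.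
move=> ZY YX [C [cC CE]]; exists C; split=> // L.
by split=> [ZL|[YL nC]]; [split; [exact: ZY|case/CE: ZL]|apply/CE; split; [exact: YX|]].
Qed.

Section LocallyPolynomial.
Variables (V V' : vectType F).
Variables (X : {vspace V} -> Prop) (Y : {vspace V'} -> Prop).
Variable (phi : {vspace V} -> {vspace V'}).
Hypotheses (XP : forall L, X L -> PP L) (phi_maps : forall L, X L -> Y (phi L)).
Hypothesis charts : forall L, X L -> exists W d G,
  [/\ zopen X W, W L, hmap d G & forall L' v, W L' -> v \in L' -> v != 0 ->
      G v != 0 /\ phi L' = <[G v]>%VS].

(* If q is homogeneous, vanishes off the chart W around L but not at L, and p *)
(* vanishes on Z, then q (p o G) vanishes on phi^-1 Z. *)
Lemma chart_cont U : zopen Y U -> zopen X (fun L => X L /\ U (phi L)).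
Proof.
move=> [Z [cZ UE]]; exists (zclosure (fun L => X L /\ Z (phi L))).
split=> [|L]; first exact: zclosed_zclosure.
split=> [[XL /UE[YL nZ]]|[XL nZ]]; split=> //; last first.
  apply/UE; split; first exact: phi_maps.
  move=> ZL; apply: nZ; split; first exact: XP.
  by move=> d p hp; apply.
move=> cL; apply: nZ; apply: cZ.
have PL := XP XL; have v0 := PP_vpick PL.
have [W [e [G [[C [cC WE]] WL hG GE]]]] := charts XL.
have [Gv0 phiL] := GE _ _ WL (memv_pick L) v0.
split=> [|d p hp Hp]; first by rewrite phiL; exact: PP_vline.
rewrite phiL; apply: (hev_vanish hp); apply: contrapT => /eqP pG.
have [_ nC] := (WE L).1 WL; apply: nC; apply: cC; split=> // d' q hq Hq.
rewrite (PP_vpickE PL); apply: (hev_vanish hq).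
have : hev q (vpick L) * hev p (G (vpick L)) = 0.
  apply: (zclosure_hfun _ (hfunM (hfun_hev hq) (hfun_comp (hfun_hev hp) hG)) _ cL (memv_pick L)).
    by move=> L' [/XP].
  move=> L' u [XL' ZL'] uL' u0.
  have [CL'|nC] := pselect (C L'); first by rewrite (Hq _ CL' _ uL') mul0r.
  have WL' : W L' by apply/WE.
  have [Gu0 phiL'] := GE _ _ WL' uL' u0.
  by rewrite [X in _ * X](Hp _ ZL') ?mulr0 // phiL' memv_line.
by move=> /eqP; rewrite mulf_eq0 (negbTE pG) orbF => /eqP.
Qed.

Lemma chart_reg U f : zopen Y U -> regular U f ->
  regular (fun L => X L /\ U (phi L)) (fun L => f (phi L)).
Proof.
move=> oU rf L [XL UL].
have [W' [d [p [q [oW' W'L hp hq fE]]]]] := rf _ UL.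
have [W [e [G [oW WL hG GE]]]] := charts XL.
have [p' hp' p'E] := hfun_comp (hfun_hev hp) hG.
have [q' hq' q'E] := hfun_comp (hfun_hev hq) hG.
exists (fun L' => (X L' /\ W' (phi L')) /\ W L'), (d * e)%N, p', q'; split=> //.
- apply: (@zopen_sub _ X); last 1 first.
  + by apply: zopenI oW; apply/chart_cont/(zopen_trans oU).
  + move=> L' [[XL' W'L'] _]; split=> //.
    by have [Z [_ ZE]] := oW'; case/ZE: W'L'.
  + by move=> L' [].
- by move=> L' v [[XL' W'L'] WL'] vL' v0; rewrite p'E q'E;
    have [Gv0 phiL'] := GE _ _ WL' vL' v0; apply: fE => //; rewrite phiL' memv_line.
Qed.

Definition chart_morphism : morphism X Y := Morphism phi_maps chart_cont chart_reg.

End LocallyPolynomial.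
End HomogeneousMaps.

(** * Composition of morphisms *)

Section CompositeMorphism.
Variables (F : fieldType) (V V' V'' : vectType F).
Variables (X : {vspace V} -> Prop) (Y : {vspace V'} -> Prop) (Z : {vspace V''} -> Prop).
Variables (g : morphism Y Z) (f : morphism X Y).

Fact comp_maps L : X L -> Z (g (f L)).
Proof. by move=> /(mor_maps f)/(mor_maps g). Qed.

Fact comp_domE U : (fun L => X L /\ (Y (f L) /\ U (g (f L)))) = (fun L => X L /\ U (g (f L))).
Proof.
apply/funext => L; apply/propext; split=> [[? []] //|[XL ?]].
by do !split=> //; exact: mor_maps.
Qed.

Fact comp_cont U : zopen Z U -> zopen X (fun L => X L /\ U (g (f L))).
Proof. by move=> /(mor_cont g)/(mor_cont f); rewrite comp_domE. Qed.

Fact comp_reg U h : zopen Z U -> regular U h ->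
  regular (fun L => X L /\ U (g (f L))) (fun L => h (g (f L))).
Proof.
move=> oU /(mor_reg g oU)/(mor_reg f (mor_cont g oU)).
by rewrite comp_domE.
Qed.

Definition comp_morphism : morphism X Z := Morphism comp_maps comp_cont comp_reg.

End CompositeMorphism.

(** * The rational normal curve as a closure *)

Section RationalNormalCurve.
Variables (F : numFieldType).

Lemma poly_eq0_horner (q : {poly F}) : (forall s, s != 0 -> q.[s] = 0) -> q = 0.
Proof.
move=> q0; apply/eqP; apply: contraT => qn0.
pose r : seq F := [seq k.+1%:R | k <- iota 0 (size q)].
have /(max_poly_roots qn0) H : all (root q) r.
  by apply/allP => _ /mapP[k _ ->]; rewrite /root q0 // pnatr_eq0.
have : uniq r.
  rewrite map_inj_uniq ?iota_uniq // => k k' /eqP.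
  by rewrite eqr_nat eqSS => /eqP.
by move=> /H; rewrite size_map size_iota ltnn.
Qed.

(** Serves to pass to the point at infinity: a polynomial in s that vanishes for all s <> 0 also
    vanishes at 0. *)
Lemma hfun_line (V : vectType F) d (f : V -> F) u v : hfun d f ->
  exists q : {poly F}, forall s, q.[s] = f (s *: u + v).
Proof.
move=> [p hp H].
exists (mmap polyC (fun i => coord (vbasis {:V}) i u *: 'X + (coord (vbasis {:V}) i v)%:P) p).
move=> s; rewrite -H /hev mevalE /mmap horner_sum; apply: eq_bigr => m _.
rewrite hornerM hornerC horner_prod; congr (_ * _); apply: eq_bigr => i _.
by rewrite horner_exp hornerD hornerZ hornerX hornerC linearD linearZ /= mulrC.
Qed.

Definition row2 (s t : F) : 'rV[F]_2 := \row_j (if j == 0 then s else t).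

Lemma row2E (x : 'rV[F]_2) : x = row2 (x 0 0) (x 0 1).
Proof. by apply/rowP => j; rewrite mxE; case: j => [[|[|]]] //= ?; congr (x _ _); exact: val_inj. Qed.

Lemma row2_0 s t : row2 s t 0 0 = s. Proof. by rewrite mxE. Qed.
Lemma row2_1 s t : row2 s t 0 1 = t. Proof. by rewrite mxE. Qed.

Lemma row2Z c s t : c *: row2 s t = row2 (c * s) (c * t).
Proof. by apply/rowP => j; rewrite !mxE; case: ifP. Qed.

Lemma row2_eq0 (x : 'rV[F]_2) : (x == 0) = (x 0 0 == 0) && (x 0 1 == 0).
Proof.
apply/eqP/andP => [->|[/eqP E0 /eqP E1]]; first by rewrite !mxE.
by rewrite [x]row2E E0 E1; apply/rowP => j; rewrite !mxE if_same.
Qed.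

Lemma hfun_entry j : hfun 1 (fun x : 'rV[F]_2 => x 0 j).
Proof.
have lin : linear (fun x : 'rV[F]_2 => x 0 j : F^o) by move=> c x y; rewrite !mxE.
exact: (hfun_scalar (HB.pack (fun x : 'rV[F]_2 => x 0 j : F^o)
  (GRing.isLinear.Build F 'rV[F]_2 F^o _ _ lin) : {linear 'rV[F]_2 -> F^o})).
Qed.

Section Curve.
Variables (V : vectType F) (D : nat) (W : D.+1.-tuple V).

Definition nrc (x : 'rV[F]_2) : V :=
  \sum_(k < D.+1) (x 0 0 ^+ (D - k) * x 0 1 ^+ k) *: W`_k.

Lemma hmap_nrc : hmap D nrc.
Proof.
apply: hmap_sum => k; have := hfunM (hfunX (D - k) (hfun_entry 0)) (hfunX k (hfun_entry 1)).
by rewrite !mul1n subnK // -ltnS.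
Qed.

Lemma nrcZ c x : nrc (c *: x) = c ^+ D *: nrc x.
Proof. exact: hmap_scale hmap_nrc. Qed.

Lemma nrc_affine (x : 'rV[F]_2) : x 0 0 != 0 -> nrc x = x 0 0 ^+ D *: nrc (row2 1 (x 0 1 / x 0 0)).
Proof. by move=> x0; rewrite -nrcZ row2Z mulr1 mulrC divfK // -row2E. Qed.

Hypothesis Wfree : free W.

Lemma coord_nrc (k : 'I_D.+1) x : coord W k (nrc x) = x 0 0 ^+ (D - k) * x 0 1 ^+ k.
Proof. exact: coord_sum_free. Qed.

Lemma nrc_neq0 x : x != 0 -> nrc x != 0.
Proof.
move=> x0; apply/eqP => n0.
have H k := coord_nrc k x; rewrite n0 in H.
have /esym/eqP := H ord0; have /esym/eqP := H ord_max.
rewrite !linear0 subnn subn0 !expr0 mulr1 mul1r !expf_eq0 => /andP[_ x1] /andP[_ x00].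
by rewrite row2_eq0 x00 x1 in x0.
Qed.

Definition affine_curve (L : {vspace V}) : Prop := exists t, L = <[nrc (row2 1 t)]>%VS.

Lemma row2_neq0 t : row2 1 t != 0.
Proof. by rewrite row2_eq0 row2_0 oner_eq0. Qed.

Lemma affine_PP L : affine_curve L -> PP L.
Proof. by move=> [t ->]; apply/PP_vline/nrc_neq0/row2_neq0. Qed.

Lemma nrc_closure x : x != 0 -> zclosure affine_curve <[nrc x]>%VS.
Proof.
move=> x0; split; first exact/PP_vline/nrc_neq0.
move=> d p hp Hp; apply: (hev_vanish hp).
have hF : hfun (d * D) (fun x => hev p (nrc x)) := hfun_comp (hfun_hev hp) hmap_nrc.
have aff (y : 'rV[F]_2) : y 0 0 != 0 -> hev p (nrc y) = 0.
  move=> y0; rewrite nrc_affine // (hevZ _ _ hp).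
  by rewrite (Hp _ (ex_intro _ (y 0 1 / y 0 0) erefl) _ (memv_line _)) mulr0.
have [q qE] := hfun_line (row2 1 0) (row2 0 (x 0 1)) hF.
have sE s : s *: row2 1 0 + row2 0 (x 0 1) = row2 s (x 0 1).
  by apply/rowP => j; rewrite !mxE; case: ifP; rewrite ?mulr1 ?mulr0 ?addr0 ?add0r.
have := qE (x 0 0); rewrite sE -row2E => <-; rewrite (@poly_eq0_horner q) ?horner0 // => s s0.
by rewrite qE sE; apply: aff; rewrite row2_0.
Qed.

(* The curve is cut out by linear equations and the quadrics                  *)
(* x_j x_k = x_j' x_k', j + k = j' + k'. *)
Lemma closure_nrc L : zclosure affine_curve L -> exists2 x, x != 0 & L = <[nrc x]>%VS.
Proof.
move=> cL; have PL := cL.1; have v0 := PP_vpick PL; have vL := memv_pick L.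
pose X k : V -> F := coord W k; set v := vpick L in v0 vL.
have gen d (f : V -> F) : hfun d f -> (forall t, f (nrc (row2 1 t)) = 0) -> f v = 0.
  move=> hf f0; apply: (zclosure_hfun affine_PP hf _ cL vL) => _ u [t ->].
  by move=> /vlineP[c ->] _; rewrite (hfun_scale _ _ hf) f0 mulr0.
have vE : v = \sum_k X k v *: W`_k.
  apply/eqP; rewrite -subr_eq0; apply/eqP.
  rewrite [LHS](coord_vbasis (memvf _)) big1 // => i _.
  pose r (u : V) := u - \sum_k X k u *: W`_k.
  have r_lin : linear (fun u => coord (vbasis {:V}) i (r u) : F^o).
    move=> c u u'; rewrite -linearP; congr coord; rewrite /r.
    rewrite scalerBr scaler_sumr addrACA -opprD -big_split; congr (_ - _).
    by apply: eq_bigr => k _ /=; rewrite scalerA -scalerDl /X linearP.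
  rewrite (gen 1%N (fun u => coord (vbasis {:V}) i (r u))) ?scale0r // => [|t].
    exact: (hfun_scalar (HB.pack (fun u => coord (vbasis {:V}) i (r u) : F^o)
      (GRing.isLinear.Build F V F^o _ _ r_lin) : {linear V -> F^o})).
  rewrite /r; under eq_bigr => k _ do rewrite /X coord_nrc.
  by rewrite subrr linear0.
have quad (j k j' k' : 'I_D.+1) : (j + k = j' + k')%N -> X j v * X k v = X j' v * X k' v.
  move=> E; apply/eqP; rewrite -subr_eq0; apply/eqP.
  apply: (gen 2 (fun u => X j u * X k u - X j' u * X k' u)) => [|t].
    by apply: hfunB; apply: (hfunM (hfun_scalar _) (hfun_scalar _)).
  by rewrite /X !coord_nrc row2_0 row2_1 !expr1n !mul1r -!exprD E subrr.
have param c (x : 'rV[F]_2) : c != 0 -> x != 0 ->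
    (forall k : 'I_D.+1, X k v = c * (x 0 0 ^+ (D - k) * x 0 1 ^+ k)) ->
    exists2 x, x != 0 & L = <[nrc x]>%VS.
  move=> c0 x0 E; exists x => //; rewrite (PP_lineE PL vL v0) vE -[RHS](vlineZ _ c0).
  by congr <[_]>%VS; rewrite scaler_sumr; apply: eq_bigr => k _; rewrite E scalerA.
(* If X_0 <> 0, the relations X_0 X_(k+1) = X_1 X_k give the parameter X_1 / X_0; for D = 0 the
   index [inord 1] defaults to 0, harmlessly as only k = 0 occurs. If X_0 = 0, the relations
   X_(k+1)^2 = X_k X_(k+2) kill all coordinates but the last, which leaves the point at infinity. *)
have [X0|X0] := eqVneq (X ord0 v) 0; last first.
  apply: (param (X ord0 v) (row2 1 (X (inord 1) v / X ord0 v))) => // [|k].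
    exact: row2_neq0.
  rewrite row2_0 row2_1 expr1n mul1r; case: k => k; elim: k => [|k IH] kD.
    by rewrite expr0 mulr1; congr (X _ v); exact: val_inj.
  have E := quad ord0 (Ordinal kD) (inord 1) (Ordinal (ltnW kD)).
  apply: (mulfI X0); rewrite E ?inordK //; last exact: (leq_ltn_trans _ kD).
  rewrite IH exprS; move: (_ ^+ k) => y.
  by rewrite mulrCA; congr (_ * _); rewrite mulrA [X ord0 v * _]mulrC divfK.
have Xk k (kD : (k < D.+1)%N) : (k < D)%N -> X (Ordinal kD) v = 0.
  elim: k kD => [|k IH] kD ltD; first by rewrite -[RHS]X0; congr (X _ v); exact: val_inj.
  have E := quad (Ordinal kD) (Ordinal kD) (Ordinal (ltnW kD)) (Ordinal (ltD : k.+2 < D.+1)%N).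
  apply/eqP; rewrite -[_ == 0]orbb -mulf_eq0 E /=; last by rewrite addSnnS.
  by rewrite IH ?mul0r // ltnW.
have Xall k : X k v = X ord_max v * (0 ^+ (D - k) * 1 ^+ k).
  rewrite expr1n mulr1; have [kD|Dk] := ltnP k D.
    have := Xk k (ltn_ord k) kD; rewrite -subn_gt0 in kD.
    rewrite expr0n eqn0Ngt kD mulr0 => <-; congr (X _ v); exact: val_inj.
  have -> : k = ord_max by apply/val_inj/eqP; rewrite eqn_leq Dk -ltnS ltn_ord.
  by rewrite subnn expr0 mulr1.
apply: (param (X ord_max v) (row2 0 1)) => [||k]; last by rewrite row2_0 row2_1.
  apply: contraNneq v0 => XD; rewrite vE big1 // => k _.
  by rewrite Xall XD mul0r scale0r.
by rewrite row2_eq0 row2_1 oner_eq0 andbF.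
Qed.

End Curve.
End RationalNormalCurve.

(** * Isomorphism with the projective line, and pullback of O(1) *)

Section NormalCurveIso.
Variables (F : numFieldType).

Lemma hmap_row2 (V : vectType F) d (f g : V -> F) :
  hfun d f -> hfun d g -> hmap d (fun v => row2 (f v) (g v)).
Proof.
move=> hf hg l.
have := hfunB (hfunZ (l (row2 1 0)) hf) (hfunZ (- l (row2 0 1)) hg).
apply: eq_hfun => v; rewrite mulNr opprK.
have -> : row2 (f v) (g v) = f v *: row2 1 0 + g v *: row2 0 1.
  by apply/rowP => j; rewrite !mxE; case: ifP; rewrite ?mulr1 ?mulr0 ?addr0 ?add0r.
by rewrite linearD !linearZ /= mulrC [g v *: _]mulrC.
Qed.

Section Iso.
Variables (V : vectType F) (d : nat) (W : d.+2.-tuple V).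
Hypothesis Wfree : free W.

Let chart0 (v : V) := row2 (coord W ord0 v) (coord W (inord 1) v).
Let chart1 (v : V) := row2 (coord W (inord d) v) (coord W ord_max v).

Lemma chart0_nrc c x : chart0 (c *: nrc W x) = (c * x 0 0 ^+ d) *: x.
Proof.
rewrite [x in RHS]row2E row2Z /chart0 !linearZ /= !coord_nrc //.
rewrite inordK // subn0 subSS subn0 expr0 mulr1 expr1 exprSr row2_0.
by congr (row2 _ _); ring.
Qed.

Lemma chart1_nrc c x : chart1 (c *: nrc W x) = (c * x 0 1 ^+ d) *: x.
Proof.
rewrite [x in RHS]row2E row2Z /chart1 !linearZ /= !coord_nrc //.
rewrite inordK // subnn subSn // subnn expr0 mul1r expr1 exprSr row2_1.
by congr (row2 _ _); ring.
Qed.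

(** The inverse is [X_0 : X_1] or [X_d : X_(d+1)]. On the image of x these are x_0^d x and x_1^d x,
    so they agree wherever both are nonzero. *)
Definition nrc_inv (L : {vspace V}) : {vspace 'rV[F]_2} :=
  if coord W ord0 (vpick L) != 0 then <[chart0 (vpick L)]>%VS
  else <[chart1 (vpick L)]>%VS.

Lemma nrc_invK x : x != 0 -> nrc_inv <[nrc W x]>%VS = <[x]>%VS.
Proof.
move=> x0; have [c c0 E] := vpick_vline (nrc_neq0 Wfree x0).
rewrite /nrc_inv E linearZ /= coord_nrc //= expr0 mulr1 mulf_eq0 negb_or c0 /=.
rewrite expf_eq0 /= chart0_nrc chart1_nrc; case: eqP => x00 /=; last first.
  by rewrite vlineZ // mulf_neq0 // expf_neq0 //; exact/eqP.
rewrite vlineZ // mulf_neq0 // expf_neq0 //; move: x0.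
by rewrite row2_eq0 x00 eqxx.
Qed.

Lemma nrc_isoS : exists phi : morphism (@PP F 'rV[F]_2) (zclosure (affine_curve W)),
  is_iso phi /\ forall x, x != 0 -> phi <[x]>%VS = <[nrc W x]>%VS.
Proof.
pose f (L : {vspace 'rV[F]_2}) := <[nrc W (vpick L)]>%VS.
have fE x : x != 0 -> f <[x]>%VS = <[nrc W x]>%VS.
  move=> /vpick_vline[c c0 E]; rewrite /f E nrcZ vlineZ //.
  exact: expf_neq0.
have f_maps L : PP L -> zclosure (affine_curve W) (f L).
  by move=> PL; apply: nrc_closure => //; exact: PP_vpick.
have f_charts L : PP L -> exists U e G,
    [/\ zopen (@PP F _) U, U L, hmap e G & forall L' v, U L' -> v \in L' -> v != 0 ->
      G v != 0 /\ f L' = <[G v]>%VS].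
  move=> PL; exists (@PP F 'rV[F]_2), d.+1, (nrc W).
  split=> //; [exact: zopenxx|exact: hmap_nrc|] => L' v PL' vL' v0.
  by rewrite nrc_neq0 // (PP_lineE PL' vL' v0) fE.
have CP L : zclosure (affine_curve W) L -> PP L by case.
have g_maps L : zclosure (affine_curve W) L -> PP (nrc_inv L).
  by move=> /(closure_nrc Wfree)[x x0 ->]; rewrite nrc_invK //; exact: PP_vline.
(* Covers both charts: where the k-th coordinate is nonzero, G gives the line of x, whichever branch
   [nrc_inv] takes. *)
have g_chart (G : V -> 'rV[F]_2) (k : 'I_d.+2) (cx : 'rV[F]_2 -> F) L : hmap 1 G ->
    (forall x, coord W k (nrc W x) = cx x ^+ d.+1) ->
    (forall c x, G (c *: nrc W x) = (c * cx x ^+ d) *: x) ->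
    zclosure (affine_curve W) L -> coord W k (vpick L) != 0 ->
    exists U e G,
    [/\ zopen (zclosure (affine_curve W)) U, U L, hmap e G &
      forall L' v, U L' -> v \in L' -> v != 0 ->
      G v != 0 /\ nrc_inv L' = <[G v]>%VS].
  move=> hG kE GE cL Lk.
  exists (fun L => zclosure (affine_curve W) L /\ coord W k (vpick L) != 0), 1%N, G.
  split=> //; first exact: zopen_neq0 CP (hfun_scalar (coord W k)).
  move=> L' v [/(closure_nrc Wfree)[x x0 ->] Lk'] /vlineP[c ->].
  rewrite scaler_eq0 negb_or => /andP[c0 _]; rewrite GE nrc_invK //.
  have cx0 : cx x != 0.
    have [c' _ E] := vpick_vline (nrc_neq0 Wfree x0).
    apply: contraNneq Lk' => cx0; rewrite E linearZ /= kE cx0.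
    by rewrite expr0n /= mulr0.
  have cn0 : c * cx x ^+ d != 0 by rewrite mulf_neq0 // expf_neq0.
  by rewrite vlineZ // scaler_eq0 negb_or cn0.
have g_charts L : zclosure (affine_curve W) L -> exists U e G,
    [/\ zopen (zclosure (affine_curve W)) U, U L, hmap e G &
      forall L' v, U L' -> v \in L' -> v != 0 ->
      G v != 0 /\ nrc_inv L' = <[G v]>%VS].
  move=> cL; have [x x0 LE] := closure_nrc Wfree cL.
  have [c c0 vE] := vpick_vline (nrc_neq0 Wfree x0).
  have [x00|x00] := eqVneq (x 0 0) 0.
    apply: (g_chart chart1 ord_max (fun x => x 0 1)) => //.
    - by apply: hmap_row2; exact: hfun_scalar.
    - by move=> y; rewrite coord_nrc // subnn mul1r.
    - exact: chart1_nrc.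
    rewrite LE vE linearZ /= coord_nrc // subnn mul1r mulf_neq0 // expf_neq0 //.
    by move: x0; rewrite row2_eq0 x00 eqxx.
  apply: (g_chart chart0 ord0 (fun x => x 0 0)) => //.
  - by apply: hmap_row2; exact: hfun_scalar.
  - by move=> y; rewrite coord_nrc // subn0 expr0 mulr1.
  - exact: chart0_nrc.
  by rewrite LE vE linearZ /= coord_nrc // subn0 expr0 mulr1 mulf_neq0 // expf_neq0.
exists (chart_morphism (fun L PL => PL) f_maps f_charts); split=> //.
exists (chart_morphism CP g_maps g_charts); split=> L /= PL.
  by rewrite (PP_vpickE PL) fE ?nrc_invK ?PP_vpick.
by have [x x0 ->] := closure_nrc Wfree PL; rewrite nrc_invK // fE.
Qed.

End Iso.

Lemma nrc_iso (V : vectType F) D (W : D.+1.-tuple V) : (0 < D)%N -> free W ->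
  exists phi : morphism (@PP F 'rV[F]_2) (zclosure (affine_curve W)),
  is_iso phi /\ forall x, x != 0 -> phi <[x]>%VS = <[nrc W x]>%VS.
Proof. by case: D W => // d W _; exact: nrc_isoS. Qed.

Lemma regular_ratio (V : vectType F) (l l' : 'Hom(V, F^o)) :
  regular (fun L => PP L /\ l (vpick L) != 0) (fun L => l' (vpick L) / l (vpick L) : F).
Proof.
move=> L lL; exists (fun L => PP L /\ l (vpick L) != 0), 1%N,
  (mpoly_of_form l'), (mpoly_of_form l).
split; rewrite ?mpoly_of_form_homog //; first exact: zopenxx.
move=> L' v [PL' lL'] vL' v0; rewrite !hev_form; split; last exact: twist_ratio.
apply: contraNneq lL' => lv; have [c ->] := PP_scale PL' vL' v0 (memv_pick L').
by rewrite linearZ /= lv scaler0.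
Qed.

(* Near [x], the function l' / l pulls back to a quotient p / q of forms; on  *)
(* the affine part it is l' (nrc y) / l (nrc y), so that                      *)
(* l' (nrc y) q(y) = p(y) l (nrc y) identically. *)
Lemma agree_on_affine (V : vectType F) D (W : D.+1.-tuple V)
    (Psi : morphism (@PP F 'rV[F]_2) (@PP F V)) : free W ->
  (forall t, Psi <[row2 1 t]>%VS = <[nrc W (row2 1 t)]>%VS) ->
  forall x, x != 0 -> Psi <[x]>%VS = <[nrc W x]>%VS.
Proof.
move=> Wfree aff.
have affE (y : 'rV[F]_2) : y 0 0 != 0 -> Psi <[y]>%VS = <[nrc W y]>%VS.
  move=> y0; rewrite nrc_affine // vlineZ ?expf_neq0 // -aff.
  by rewrite -[in RHS](vlineZ _ y0) row2Z mulr1 [y 0 0 * _]mulrC divfK // -row2E.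
move=> x x0; have [x00|] := eqVneq (x 0 0) 0; last exact: affE.
have Px : PP <[x]>%VS by exact: PP_vline.
have PL := mor_maps Psi Px; set w := vpick (Psi <[x]>%VS).
have w0 : w != 0 by exact: PP_vpick.
have [l [_ lw]] := twist_cover PL; rewrite -/w in lw.
have oU : zopen (@PP F V) (fun L => PP L /\ l (vpick L) != 0).
  by apply: zopen_neq0 => //; exact: hfun_form.
(* Proportionality of [nrc W x] and w is tested on all linear forms l' against the fixed form l. *)
suff key (l' : 'Hom(V, F^o)) : (l' (nrc W x) * l w : F) = l' w * l (nrc W x).
  have E : (l w : F) *: nrc W x = (l (nrc W x) : F) *: w.
    apply/eqP; rewrite -subr_eq0; apply/eqP.
    rewrite [LHS](coord_vbasis (memvf _)) big1 // => i _.
    have := key (linfun (coord (vbasis {:V}) i : V -> F^o)); rewrite !lfunE => E.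
    by rewrite linearB !linearZ /= mulrC E mulrC subrr scale0r.
  rewrite (PP_vpickE PL) -/w -[RHS](vlineZ _ lw) E vlineZ //.
  apply: contraTneq (nrc_neq0 Wfree x0) => ln0; rewrite negbK.
  by move/eqP: E; rewrite ln0 scale0r scaler_eq0 (negbTE lw).
have [|U' [d [p [q [oU' U'x hp hq HU]]]]] :=
  mor_reg Psi oU (@regular_ratio V l l') <[x]>%VS; first by split.
have U'sub L : U' L -> PP L /\ l (vpick (Psi L)) != 0.
  by have [Z [_ ZE]] := oU'; move=> /ZE[[PL' [_ lL']] _].
have [Z [cZ ZE]] := zopen_trans (mor_cont Psi oU) oU'.
have [r [e [hr rZ rx]]] : exists r e, [/\ r \is e.-homog,
    forall L, Z L -> vanishes_on r L & hev r x != 0].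
  apply: contrapT => H; case/ZE: U'x => _; apply; apply: cZ; split=> // e r hr rZ.
  apply: (hev_vanish hr); apply: contrapT => /eqP rx; apply: H.
  by exists r, e.
pose A (y : 'rV[F]_2) := (l' (nrc W y) : F) * hev q y - l (nrc W y) * hev p y.
have hA : hfun (D + d) A.
  by apply: hfunB; apply: hfunM; try exact: hfun_hev; exact: hmap_nrc.
have Aaff (y : 'rV[F]_2) : y 0 0 != 0 -> hev r y * A y = 0.
  move=> y00; have y0 : y != 0 by rewrite row2_eq0 negb_and y00.
  have [Zy|nZ] := pselect (Z <[y]>%VS).
    by rewrite (rZ _ Zy) ?mul0r ?memv_line.
  have U'y : U' <[y]>%VS by apply/ZE; split=> //; exact: PP_vline.
  have [qy] := HU _ _ U'y (memv_line y) y0.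
  have := (U'sub _ U'y).2; rewrite affE //.
  have Pn := PP_vline (nrc_neq0 Wfree y0).
  rewrite (twist_ratio l l' Pn (memv_line _)) ?nrc_neq0 // => lv E.
  have ln : l (nrc W y) != 0.
    have [c c0 vE] := vpick_vline (nrc_neq0 Wfree y0).
    by apply: contraNneq lv => ln; rewrite vE linearZ /= ln scaler0.
  move/eqP: E; rewrite eqr_div // => /eqP E.
  by rewrite /A E mulrC [hev p y * _]mulrC subrr mul0r.
have [Q QE] := hfun_line (row2 1 0) x (hfunM (hfun_hev hr) hA).
have xE s : s *: row2 1 0 + x = row2 s (x 0 1).
  apply/rowP => j; rewrite !mxE; case: j => [[|[|]]] //= ?.
    by rewrite mulr1 -[RHS]addr0 -x00; congr (_ + x _ _); exact: val_inj.
  by rewrite mulr0 add0r; congr (x _ _); exact: val_inj.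
have : hev r x * A x = 0.
  have := QE 0; rewrite scale0r add0r => <-.
  rewrite (@poly_eq0_horner _ Q) ?horner0 // => s s0.
  by rewrite QE xE; apply: Aaff; rewrite row2_0.
move=> /eqP; rewrite mulf_eq0 (negbTE rx) /= subr_eq0 => /eqP Ax.
have [qx] := HU _ _ U'x (memv_line x) x0; rewrite -/w => /eqP.
rewrite eqr_div // => /eqP E; apply: (mulIf qx).
by rewrite mulrAC Ax [RHS]mulrAC E; ring.
Qed.

(** The i-th form composed with [nrc] has degree D in x, like the D-th power of a form k on the
    plane; their ratio is the change of trivialization. *)
Lemma lb_iso_twist (V : vectType F) D (W : D.+1.-tuple V)
    (E : line_bundle (@PP F 'rV[F]_2)) (form : lb_idx E -> 'Hom(V, F^o)) :
  (forall i L, lb_dom i L -> form i (nrc W (vpick L)) != 0) ->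
  (forall i j L, lb_dom i L -> lb_dom j L ->
     lb_trans i j L = form j (nrc W (vpick L)) / form i (nrc W (vpick L))) ->
  lb_iso E (twist 'rV[F]_2 D).
Proof.
move=> dom0 transE.
exists (fun (k : 'Hom('rV[F]_2, F^o)) i L => (form i (nrc W (vpick L)) : F) / (k (vpick L) : F) ^+ D); split.
- move=> k i L kiL; have [p hp pE] := hmap_nrc W (form i).
  have [q hq qE] := hfunX D (hfun_form k); rewrite mul1n in hq.
  exists (fun L => lb_dom (k : lb_idx (twist _ D)) L /\ lb_dom i L), D, p, q.
  split=> //; first exact: zopenxx.
  move=> L' v [[PL' kL'] _] vL' v0; have [c vE] := PP_scale PL' vL' v0 (memv_pick L').
  rewrite pE qE; have kv : k v != 0.
    by apply: contraNneq kL' => kv; rewrite vE linearZ /= kv scaler0.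
  split; first exact: expf_neq0.
  have c0 : c != 0.
    by apply: contraNneq kL' => c0; rewrite vE c0 scale0r linear0.
  have -> : k (vpick L') = c * k v :> F by rewrite vE linearZ.
  have -> : form i (nrc W (vpick L')) = c ^+ D * form i (nrc W v) :> F.
    by rewrite vE nrcZ linearZ.
  by rewrite exprMn -mulf_div divff ?mul1r // expf_neq0.
- move=> k i L [PL kL] iL; rewrite mulf_neq0 ?dom0 // invr_eq0.
  exact: expf_neq0.
- move=> k l i j L [PL kL] [_ lL] iL jL; rewrite transE //= -exprnP.
  have := dom0 _ _ iL; move: (form i _ : F) (form j _ : F) => x y x0.
  rewrite expr_div_n mulrC mulrA divfK // [RHS]mulrC mulrA divfK //.
  exact: expf_neq0.
Qed.

End NormalCurveIso.

(** * Orbits of exponentials of nilpotent operators *)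

Section NilpotentOrbit.
Variables (F : numFieldType) (V : vectType F) (N : 'End(V)) (v : V) (D : nat).
Hypotheses (NDv : iter D N v != 0) (NDv1 : iter D.+1 N v = 0).

Definition orbit_tuple : D.+1.-tuple V :=
  [tuple (k : nat)`!%:R^-1 *: iter k N v | k < D.+1].

Lemma iter_End_linear k : linear (iter k N).
Proof. by elim: k => // k IH c x y; rewrite iterS IH linearP. Qed.

Lemma iter_ge k : (D < k)%N -> iter k N v = 0.
Proof.
move=> /subnK <-; elim: (k - _)%N => // j IH.
by rewrite addSn iterS IH linear0.
Qed.

(** Applying N^(D - k) to a relation kills the terms beyond k; those before k vanish by induction,
    which isolates the k-th coefficient. *)
Lemma orbit_tuple_free : free orbit_tuple.
Proof.
apply/freeP => c; under eq_bigr => k _ do rewrite -tnth_nth tnth_mktuple scalerA.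
move=> c0 k; apply/eqP; suff : c k / (k : nat)`!%:R == 0.
  by rewrite mulf_eq0 invr_eq0 pnatr_eq0 -leqn0 leqNgt fact_gt0 orbF.
pose g (k : nat) := if insub k is Some k then c k / (k : 'I_D.+1)`!%:R else 0.
have gE (j : 'I_D.+1) : c j / j`!%:R = g j by rewrite /g valK.
rewrite gE; move: c0; under eq_bigr => j _ do rewrite gE.
move=> g0; case: k => k /=; elim/ltn_ind: k => k IH kD.
have := congr1 (iter (D - k) N) g0.
pose L := HB.pack (iter (D - k) N) (GRing.isLinear.Build F V V _ _ (iter_End_linear (D - k))) : {linear V -> V}.
rewrite -[iter _ N]/(L : V -> V) linear0 linear_sum (bigD1 (Ordinal kD)) //= big1 => [|j jk].
  rewrite addr0 -[iter _ N]/(L : V -> V) linearZ /= -iterD subnK -1?ltnS // => /eqP.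
  by rewrite scaler_eq0 (negbTE NDv) orbF.
rewrite -[iter _ N]/(L : V -> V) linearZ /= -iterD; have [kj|jk'] := ltnP k j.
  rewrite iter_ge ?scaler0 //; move: (ltn_ord j); lia.
have jk2 : (j < k)%N.
  by rewrite ltn_neqAle jk' andbT; apply: contraNneq jk => E; apply/eqP/val_inj.
by rewrite (eqP (IH _ jk2 (ltn_ord j))) scale0r.
Qed.

Lemma nexp_nrc t : nexp (t *: N) v = nrc orbit_tuple (row2 1 t).
Proof.
have itZ k : iter k (t *: N) v = t ^+ k *: iter k N v.
  elim: k => [|k IH]; first by rewrite scale1r.
  by rewrite !iterS IH scale_lfunE linearZ /= scalerA exprS.
(* [nexp] stops at the dimension of V; freeness of the D + 1 vectors ensures that no nonzero term is
   lost. *)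
have dimD : (D.+1 <= (\dim {:V}).+1)%N.
  have := orbit_tuple_free; rewrite /free size_tuple => /eqP <-.
  exact/leqW/dimvS/subvf.
rewrite /nexp /nrc (big_ord_widen _ (fun k => (row2 1 t 0 0 ^+ (D - k) *
  row2 1 t 0 1 ^+ k) *: orbit_tuple`_k) dimD) [RHS]big_mkcond.
apply: eq_bigr => k _; rewrite itZ row2_0 row2_1 expr1n mul1r; case: ltnP => kD.
  rewrite -[k : nat]/(Ordinal kD : nat) -tnth_nth tnth_mktuple /= !scalerA.
  by rewrite mulrC.
by rewrite iter_ge // !scaler0.
Qed.

End NilpotentOrbit.

(** * The orbit of the cyclic vector in the fusion product *)

Section FusionOrbit.
Variables (F : numFieldType) (n : nat) (a : 'I_n -> nat) (z : 'I_n -> F).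
Variables (M : fusion a z) (i : 'I_n).
Local Notation e_i := (fus_act M (delta_mx 0 1) i).

Definition deg_curve := (\sum_(l < n | (l < n - i)%N) (a l).-1)%N.

Lemma Fil_iter t : Fil z (i * t) (iter t (@cure F n a z i) (lowest F a)).
Proof.
elim: t => [|t IH]; first by rewrite muln0; exact: (Fil_emon a z [::]).
by rewrite mulnS addnC iterS; exact: Fil_cure.
Qed.

(** Since e_i^t v is the class of an element of F_(i t), [fus_ker] turns its vanishing into
    membership in F_(i t - 1). *)
Lemma iter_fus_act t : iter t e_i (fus_vec M) =
  fus_cls M (i * t) (iter t (@cure F n a z i) (lowest F a)).
Proof.
elim: t => [|t IH]; first by rewrite muln0.
rewrite iterS IH fus_actE ?cur_e -?iterS 1?addnC -?mulnS //; last exact: Fil_iter.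
by rewrite /mxtrace !big_ord_recl big_ord0 !mxE /= !addr0.
Qed.

Hypotheses (z_inj : injective z) (ha : forall l, (0 < a l)%N).
Hypothesis a_incr : forall j k : 'I_n, (j < k)%N -> (a j <= a k)%N.

Lemma iter_fus_act_neq0 : iter deg_curve e_i (fus_vec M) != 0.
Proof.
apply/eqP; rewrite iter_fus_act => /(fus_ker M (Fil_iter _)).
exact: iter_cure_lower.
Qed.

Lemma iter_fus_act_eq0 : iter deg_curve.+1 e_i (fus_vec M) = 0.
Proof. by rewrite iter_fus_act; apply/(fus_ker M (Fil_iter _))/iter_cure_upper. Qed.

Definition curve_tuple := orbit_tuple e_i (fus_vec M) deg_curve.

Lemma curve_tuple_free : free curve_tuple.
Proof. exact: orbit_tuple_free iter_fus_act_neq0 iter_fus_act_eq0. Qed.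

Lemma nexp_fus_vec t : nexp (t *: e_i) (fus_vec M) = nrc curve_tuple (row2 1 t).
Proof. exact: nexp_nrc iter_fus_act_neq0 iter_fus_act_eq0 t. Qed.

Lemma curveE : curve M i = zclosure (affine_curve curve_tuple).
Proof.
rewrite /curve; congr zclosure; apply/funext => L; apply/propext.
by split=> -[t ->]; exists t; rewrite nexp_fus_vec.
Qed.

End FusionOrbit.

Theorem lemma3p2 (R : realType) (n : nat) (hn : (0 < n)%N)
    (* sh^(n), realized as sh_B for some B with distinct entries b_j >= 2 (so
       that C_0, ..., C_(n-1) are lines) *)
    (b : 'I_n -> nat) (hb : forall j, (1 < b j)%N)
    (hb_incr : forall j k : 'I_n, (j < k)%N -> (b j < b k)%N)
    (zb : 'I_n -> complex R) (hzb : injective zb) (MB : fusion b zb)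
    (a : 'I_n -> nat) (ha : forall j, (0 < a j)%N)
    (ha_incr : forall j k : 'I_n, (j < k)%N -> (a j < a k)%N)
    (za : 'I_n -> complex R) (hza : injective za) (MA : fusion a za)
    (iota : morphism (sh MB) (@PP _ (fus_space MA)))
    (hiota : realizes iota) :
  is_O (pullback iota (twist (fus_space MA) 1)) (fun j => (a j)%:Z - 1).
Proof.
move=> i.
have hb0 l : (0 < b l)%N by exact: ltnW.
have hbW (j k : 'I_n) : (j < k)%N -> (b j <= b k)%N by move=> /hb_incr/ltnW.
have haW (j k : 'I_n) : (j < k)%N -> (a j <= a k)%N by move=> /ha_incr/ltnW.
pose WB := @curve_tuple _ n b zb MB i; pose WA := @curve_tuple _ n a za MA i.
have WBfree : free WB by exact: curve_tuple_free.
have WAfree : free WA by exact: curve_tuple_free.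
(* The factor 0 is always among the first n - i, and it contributes b_0 - 1 > 0. *)
have DB : (0 < deg_curve b i)%N.
  have i0 : (0 < n - i)%N by rewrite subn_gt0.
  by rewrite /deg_curve (bigD1 (Ordinal hn)) //= addn_gt0 -subn1 subn_gt0 hb.
have [phi [phi_iso phiE]] : exists phi : morphism (@PP _ 'rV[R[i]]_2) (curve MB i),
    is_iso phi /\ forall x, x != 0 -> phi <[x]>%VS = <[nrc WB x]>%VS.
  by rewrite curveE //; exact: nrc_iso.
exists phi; split=> //.
pose Psi := comp_morphism iota (comp_morphism (incl (curve_sub MB i)) phi).
have PsiE x : x != 0 -> Psi <[x]>%VS = <[nrc WA x]>%VS.
  (* On the affine part, the same group element exp(t e_i) is applied to v_B and to v_A, where
     equivariance determines iota. *)
  apply: agree_on_affine WAfree _ x => t /=.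
  rewrite phiE ?row2_neq0 // -!nexp_fus_vec // -!fus_cur_monomial.
  by apply: hiota.2; apply: Gact_e; exact: Gact1.
have degE : \sum_(j < n | (j < n - i)%N) ((a j)%:Z - 1) = (deg_curve a i)%:Z.
  by rewrite /deg_curve raddf_sum; apply: eq_bigr => j _; rewrite -subn1 subzn.
rewrite degE; set E := pullback phi _.
(* The charts of O(1) are indexed by linear forms on M^A, so an index of E is its own form. *)
apply: (@lb_iso_twist _ _ _ WA E (fun l => l)) => [l L|l l' L].
  move=> [PL [_ [_ [_ lL]]]]; have v0 := PP_vpick PL.
  have [c c0 vE] := vpick_vline (nrc_neq0 WAfree v0).
  apply: contraNneq lL => ln; move: (PsiE _ v0); rewrite -PP_vpickE //= => ->.
  by rewrite vE linearZ /= ln scaler0.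
move=> [PL [_ [_ [PPsi _]]]] _; have v0 := PP_vpick PL.
rewrite /= expr1z; apply: twist_ratio => //; last exact: nrc_neq0.
by move: (PsiE _ v0); rewrite -PP_vpickE //= => ->; exact: memv_line.
Qed.
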